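(* Let problem $\mathcal P_{\hat p}(0,x_0)$ (see context) be affine, i.e. $g$ and $f$ are affine with respect to $u$, with $U$ a convex compact polyhedron, and let Assumptions (A1), (A2) and (C1) stated in the context be fulfilled. Let the metric $d^*$ in $Y$ be defined through the set $\Gamma=\{s\in[0,T]:\langle\hat\sigma(s),e\rangle=0\text{ for some }e\in E\}$. Then the following statements are equivalent: (i) the map $\Phi_{(\hat p,0,x_0)}:Y\rightrightarrows Z$ is strongly sub-regular at $(\hat y,0)$ in the single metric $d$ in $Y$, i.e. there are positive constants $\alpha,\beta,\kappa$ such that $d(y,\hat y)\le\kappa\|z\|$ for all $y\in Y$ with $d(y,\hat y)\le\alpha$ and all $z\in\Phi_{(\hat p,0,x_0)}(y)$ with $\|z\|\le\beta$; (ii) the map $\Phi_{(\hat p,0,x_0)}:Y\rightrightarrows Z$ is strongly sub-regular at $(\hat y,0)$ in the metrics $d$ and $d^*$ in $Y$, i.e. there are positive constants $\alpha,\beta,\kappa$ such that $d^*(y,\hat y)\le\kappa\|z\|$ for all $y\in Y$ with $d(y,\hat y)\le\alpha$ and all $z\in\Phi_{(\hat p,0,x_0)}(y)$ with $\|z\|\le\beta$.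
   Context: **Problem.** Let $T>0$, $x_0\in\mathbb R^n$, $U\subset\mathbb R^m$, $f:\mathbb R^l\times\mathbb R^n\times\mathbb R^m\to\mathbb R^n$, $g:\mathbb R^l\times\mathbb R^n\times\mathbb R^m\to\mathbb R$, $g_T:\mathbb R^n\to\mathbb R$, and let $\Pi$ be a set of bounded Lebesgue measurable functions $p:[0,T]\to\mathbb R^l$. For $\tau\in[0,T)$ let $\mathcal U_\tau=\{u\in L^\infty(\tau,T):u(t)\in U\text{ for a.e. }t\}$, $\mathcal U=\mathcal U_0$. Problem $\mathcal P_p(\tau,x_\tau)$ is: minimize over $u\in\mathcal U_\tau$ the functional $g_T(x(T))+\int_\tau^Tg(p(t),x(t),u(t))\,dt$ subject to $\dot x(t)=f(p(t),x(t),u(t))$, $x(\tau)=x_\tau$. ''Optimal solution'' means locally optimal with respect to the $L^1$-norm of the controls; it is understood that any solution $(x,u)$ of $\mathcal P_p(0,x_0)$ satisfies, together with some absolutely continuous adjoint function $\lambda$, the optimality system $0\in\Phi_{(p,0,x_0)}(x,\lambda,u)$ (defined below), and analogously for $\mathcal P_p(\tau,x_\tau)$. **Spaces and metrics.** $\|x\|_{1,1}=\|x\|_1+\|\dot x\|_1$ is the norm of the space $W^{1,1}(0,T)$ of absolutely continuous functions. $Y=W^{1,1}(0,T)\times W^{1,1}(0,T)\times\mathcal U$, $Z=L^1(0,T)\times\mathbb R^n\times L^1(0,T)\times\mathbb R^n\times L^\infty(0,T)$. For $y_i=(x_i,\lambda_i,u_i)\in Y$: $d(y_1,y_2)=\|x_1-x_2\|_{1,1}+\|\lambda_1-\lambda_2\|_{1,1}+\|u_1-u_2\|_1$.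 For $z=(\xi,\nu,\eta,\pi,\rho)\in Z$: $\|z\|=\|\xi\|_1+|\nu|+\|\eta\|_1+|\pi|+\|\rho\|_\infty$. For a finite set $\Gamma\subset[0,T]$ and $u_1,u_2\in\mathcal U$, $$d^*(u_1,u_2)=\inf\{\varepsilon>0:\ |u_1(t)-u_2(t)|\le\varepsilon\text{ for a.e. }t\in[0,T]\setminus(\Gamma+[-\varepsilon,\varepsilon])\},$$ and $d^*(y_1,y_2)=\|x_1-x_2\|_{1,1}+\|\lambda_1-\lambda_2\|_{1,1}+d^*(u_1,u_2)$. **Optimality map.** With $H(p,x,\lambda,u)=g(p,x,u)+\langle\lambda,f(p,x,u)\rangle$, $$\Phi_{(p,0,x_0)}(x,\lambda,u)=\begin{pmatrix}-\dot x+f(p,x,u)\\ x(0)-x_0\\ \dot\lambda+\nabla_xH(p,x,\lambda,u)\\ \lambda(T)-\nabla g_T(x(T))\\ \nabla_uH(p,x,\lambda,u)\end{pmatrix}+\begin{pmatrix}0\\0\\0\\0\\N_{\mathcal U}(u)\end{pmatrix},$$ where functions of $t$ are substituted pointwise and, for $u\in\mathcal U$, $N_{\mathcal U}(u)=\{l\in L^\infty(0,T):\int_0^T\langle l(t),v(t)-u(t)\rangle dt\le0\ \forall v\in\mathcal U\}$. The map $\Phi_{(p,\tau,x_\tau)}$ is defined in the same way on $[\tau,T]$, with $x(0)-x_0$ replaced by $x(\tau)-x_\tau$. **Reference solution.** Fix $\hat p\in\Pi$; $(\hat x,\hat u)$ is a solution of $\mathcal P_{\hat p}(0,x_0)$,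 $\hat\lambda$ the corresponding adjoint function, $\hat y=(\hat x,\hat\lambda,\hat u)$, so $0\in\Phi_{(\hat p,0,x_0)}(\hat y)$. The switching function is $\hat\sigma:[0,T]\to\mathbb R^m$, $\hat\sigma(t)=\nabla_uH(\hat p(t),\hat x(t),\hat\lambda(t),\hat u(t))$. $E$ is the set of all unit vectors $e\in\mathbb R^m$ that are parallel to some edge of $U$. **Assumptions.** (A1) $U$ is convex and compact; $f,g,g_T$ are twice differentiable with respect to $(x,u)$, and these functions and their first and second derivatives in $(x,u)$ are Lipschitz continuous with respect to $(p,x,u)$ with constant $L$. (A2) For every $u\in\mathcal U$, $x_0\in\mathbb R^n$, $p\in\Pi$, the equation $\dot x=f(p,x,u)$, $x(0)=x_0$, has a solution on $[0,T]$; for every $\tau\in[0,T)$, $x_\tau\in\mathbb R^n$, $p\in\Pi$, problem $\mathcal P_p(\tau,x_\tau)$ has an optimal solution. (C1) There exist $\eta_0>0$ and $\mu_0>0$ such that if $s\in[0,T]$ is a zero of $\langle\hat\sigma,e\rangle$ for some $e\in E$, then $|\langle\hat\sigma(t),e\rangle|\ge\mu_0|t-s|$ for all $t\in[s-\eta_0,s+\eta_0]\cap[0,T]$. (This assumption implies that the set $\Gamma$ in the claim is finite.) *)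

(* Defs.v *)
From HB Require Import structures.
From mathcomp Require Import all_boot all_order all_algebra.
From mathcomp Require Import all_classical all_reals all_analysis.
From mathcomp Require Import measurable_realfun ess_sup_inf.

Set Implicit Arguments.
Unset Strict Implicit.
Unset Printing Implicit Defensive.

Import Order.TTheory GRing.Theory Num.Theory.
Import numFieldNormedType.Exports.

Local Open Scope classical_set_scope.
Local Open Scope ring_scope.

(* Vectors are row vectors.  The library norm on 'rV[R]_k is the maximum norm,
   so the Euclidean structure is introduced here. *)

Definition dot (R : realType) (k : nat) (v w : 'rV[R]_k) : R :=
  \sum_(i < k) v ord0 i * w ord0 i.

Definition enorm (R : realType) (k : nat) (v : 'rV[R]_k) : R :=
  Num.sqrt (dot v v).

Definition grad (R : realType) (k : nat) (F : 'rV[R]_k -> R) (v : 'rV[R]_k) :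
  'rV[R]_k := \row_i 'D_(delta_mx ord0 i) F v.

Definition polyhedron (R : realType) (k : nat) (U : set 'rV[R]_k) : Prop :=
  exists (N : nat) (a : 'I_N -> 'rV[R]_k) (b : 'I_N -> R),
    U = [set v | forall i, dot (a i) v <= b i].

Definition segment (R : realType) (k : nat) (a b : 'rV[R]_k) : set 'rV[R]_k :=
  [set (1 - s) *: a + s *: b | s in `[0, 1]].

(* Faces are the sets of maximizers of linear functionals; the functional 0 is
   allowed, so that a segment is an edge of itself. *)
Definition is_face (R : realType) (k : nat) (U F : set 'rV[R]_k) : Prop :=
  exists c : 'rV[R]_k,
    F = [set v | U v /\ forall w, U w -> dot c w <= dot c v].

Definition edge_directions (R : realType) (k : nat) (U : set 'rV[R]_k) :
    set 'rV[R]_k :=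
  [set e | enorm e = 1 /\
     exists a b, [/\ a != b, is_face U (segment a b) &
       exists c : R, b - a = c *: e]].

Definition ae_itv (R : realType) (a b : R) (Q : R -> Prop) : Prop :=
  {ae @lebesgue_measure R, forall t, t \in `[a, b] -> Q t}.

Definition abs_continuous (R : realType) (k : nat) (a b : R)
    (x : R -> 'rV[R]_k) : Prop :=
  forall eps : R, 0 < eps -> exists2 delta : R, 0 < delta &
    forall (N : nat) (s t : 'I_N -> R),
      (forall i, [/\ a <= s i, s i <= t i & t i <= b]) ->
      trivIset setT (fun i => `]s i, t i[%classic) ->
      \sum_(i < N) (t i - s i) < delta ->
      \sum_(i < N) enorm (x (t i) - x (s i)) < eps.

(* The library measure lebesgue_measure lives on the Borel sets;
   completed_algebra_gen adjoins the subsets of Borel null sets. *)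
Definition lebesgue_measurable (R : realType) (k : nat) (a b : R)
    (v : R -> 'rV[R]_k) : Prop :=
  forall (i : 'I_k) (B : set R), measurable B ->
    completed_algebra_gen (@lebesgue_measure R)
      (`[a, b] `&` (fun t => v t ord0 i) @^-1` B).

(* Elements of the Lebesgue spaces on [a, b] are represented by functions on R
   that matter only up to a.e. equality on [a, b].  Every class has a Borel
   representative, so only Borel representatives are considered. *)

Definition Lpnorm (R : realType) (k : nat) (q : \bar R) (a b : R)
    (v : R -> 'rV[R]_k) : \bar R :=
  Lnorm (@lebesgue_measure R) q ((fun t : R => (enorm (v t))%:E) \_ `[a, b]).

Definition Lpspace (R : realType) (k : nat) (q : \bar R) (a b : R) :
    set (R -> 'rV[R]_k) :=
  [set v : R -> 'rV[R]_k | (forall i, measurable_fun `[a, b] (fun t : R => v t ord0 i)) /\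
           (Lpnorm q a b v < +oo)%E].

Definition W11norm (R : realType) (k : nat) (a b : R) (x : R -> 'rV[R]_k) :
    \bar R :=
  (Lpnorm 1%:E a b x + Lpnorm 1%:E a b (derive1 x))%E.

(* F p is twice differentiable for every p; F and its first and second
   differentials are L-Lipschitz jointly in (p, v) on the whole space Q * V.
   Letting the directions range over the unit ball amounts to using operator
   norms.  The norms are the library ones (maximum norms), which only affects
   the value of L. *)
Definition twice_diff_lipschitz (R : realType) (Q V W : normedModType R)
    (L : R) (F : Q -> V -> W) : Prop :=
  [/\ forall p v, differentiable (F p) v,
      forall h p v, differentiable ('D_h (F p)) v,
      L.-lipschitz (fun q : Q * V => F q.1 q.2),
      forall h, `|h| <= 1 ->
        L.-lipschitz (fun q : Q * V => 'D_h (F q.1) q.2) &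
      forall h k, `|h| <= 1 -> `|k| <= 1 ->
        L.-lipschitz (fun q : Q * V => 'D_k ('D_h (F q.1)) q.2)].

Record problem (R : realType) (l n m : nat) := Problem {
  horizon : R;
  init : 'rV[R]_n;
  ctrlset : set 'rV[R]_m;
  dyn : 'rV[R]_l -> 'rV[R]_n -> 'rV[R]_m -> 'rV[R]_n;
  run : 'rV[R]_l -> 'rV[R]_n -> 'rV[R]_m -> R;
  term : 'rV[R]_n -> R;
  params : set (R -> 'rV[R]_l)
}.

Definition controls (R : realType) (l n m : nat) (P : problem R l n m)
    (tau : R) : set (R -> 'rV[R]_m) :=
  [set u | Lpspace +oo%E tau (horizon P) u /\
           ae_itv tau (horizon P) (fun t => ctrlset P (u t))].

Definition trajectory (R : realType) (l n m : nat) (P : problem R l n m)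
    (p : R -> 'rV[R]_l) (tau : R) (xtau : 'rV[R]_n)
    (x : R -> 'rV[R]_n) (u : R -> 'rV[R]_m) : Prop :=
  [/\ abs_continuous tau (horizon P) x, x tau = xtau &
      ae_itv tau (horizon P)
        (fun t => is_derive t (1 : R) x (dyn P (p t) (x t) (u t)))].

(* If p is Lebesgue but not Borel measurable, so is the integrand; the library
   integral, a supremum over simple functions on the positive and negative
   parts, still has the value of the Lebesgue integral. *)
Definition cost (R : realType) (l n m : nat) (P : problem R l n m)
    (p : R -> 'rV[R]_l) (tau : R)
    (x : R -> 'rV[R]_n) (u : R -> 'rV[R]_m) : \bar R :=
  ((term P (x (horizon P)))%:E +
   \int[lebesgue_measure]_(t in `[tau, horizon P])
     (run P (p t) (x t) (u t))%:E)%E.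

Definition optimal_solution (R : realType) (l n m : nat) (P : problem R l n m)
    (p : R -> 'rV[R]_l) (tau : R) (xtau : 'rV[R]_n)
    (x : R -> 'rV[R]_n) (u : R -> 'rV[R]_m) : Prop :=
  [/\ controls P tau u, trajectory P p tau xtau x u &
      exists2 eps : R, 0 < eps &
        forall x' u', controls P tau u' -> trajectory P p tau xtau x' u' ->
          (Lpnorm 1%:E tau (horizon P) (u' \- u)%R <= eps%:E)%E ->
          (cost P p tau x u <= cost P p tau x' u')%E].

Definition hamiltonian (R : realType) (l n m : nat) (P : problem R l n m)
    (p : 'rV[R]_l) (x lam : 'rV[R]_n) (u : 'rV[R]_m) : R :=
  run P p x u + dot lam (dyn P p x u).

Definition grad_x_H (R : realType) (l n m : nat) (P : problem R l n m)
    (p : 'rV[R]_l) (x lam : 'rV[R]_n) (u : 'rV[R]_m) : 'rV[R]_n :=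
  grad (fun x' => hamiltonian P p x' lam u) x.

Definition grad_u_H (R : realType) (l n m : nat) (P : problem R l n m)
    (p : 'rV[R]_l) (x lam : 'rV[R]_n) (u : 'rV[R]_m) : 'rV[R]_m :=
  grad (fun u' => hamiltonian P p x lam u') u.

Record Ypoint (R : realType) (n m : nat) := YPoint {
  yx : R -> 'rV[R]_n;
  ylam : R -> 'rV[R]_n;
  yu : R -> 'rV[R]_m
}.

Record Zpoint (R : realType) (n m : nat) := ZPoint {
  zxi : R -> 'rV[R]_n;
  znu : 'rV[R]_n;
  zeta : R -> 'rV[R]_n;
  zpi : 'rV[R]_n;
  zrho : R -> 'rV[R]_m
}.

Definition Zzero (R : realType) (n m : nat) : Zpoint R n m :=
  ZPoint (cst 0) 0 (cst 0) 0 (cst 0).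

Definition Yspace (R : realType) (l n m : nat) (P : problem R l n m)
    (tau : R) : set (Ypoint R n m) :=
  [set y | [/\ abs_continuous tau (horizon P) (yx y),
               abs_continuous tau (horizon P) (ylam y) &
               controls P tau (yu y)]].

Definition Zspace (R : realType) (n m : nat) (a b : R) :
    set (Zpoint R n m) :=
  [set z | [/\ Lpspace 1%:E a b (zxi z), Lpspace 1%:E a b (zeta z) &
               Lpspace +oo%E a b (zrho z)]].

Definition Znorm (R : realType) (n m : nat) (a b : R) (z : Zpoint R n m) :
    \bar R :=
  (Lpnorm 1%:E a b (zxi z) + (enorm (znu z))%:E +
   Lpnorm 1%:E a b (zeta z) + (enorm (zpi z))%:E +
   Lpnorm +oo%E a b (zrho z))%E.

Definition dist (R : realType) (n m : nat) (T : R) (y1 y2 : Ypoint R n m) :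
    \bar R :=
  (W11norm 0 T (yx y1 \- yx y2)%R + W11norm 0 T (ylam y1 \- ylam y2)%R +
   Lpnorm 1%:E 0 T (yu y1 \- yu y2)%R)%E.

(* The condition excluded in the implication is membership of t in
   G + [-eps, eps]. *)
Definition dist_ctrl_star (R : realType) (m : nat) (T : R) (G : set R)
    (u1 u2 : R -> 'rV[R]_m) : \bar R :=
  ereal_inf [set eps%:E | eps in
    [set eps : R | 0 < eps /\
       ae_itv 0 T (fun t =>
         ~ (exists2 s, G s & `|t - s| <= eps) ->
         enorm (u1 t - u2 t) <= eps)]].

Definition dist_star (R : realType) (n m : nat) (T : R) (G : set R)
    (y1 y2 : Ypoint R n m) : \bar R :=
  (W11norm 0 T (yx y1 \- yx y2)%R + W11norm 0 T (ylam y1 \- ylam y2)%R +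
   dist_ctrl_star T G (yu y1) (yu y2))%E.

Definition normal_cone (R : realType) (l n m : nat) (P : problem R l n m)
    (tau : R) (u : R -> 'rV[R]_m) : set (R -> 'rV[R]_m) :=
  [set w | Lpspace +oo%E tau (horizon P) w /\
     forall v, controls P tau v ->
       (\int[lebesgue_measure]_(t in `[tau, horizon P])
          (dot (w t) (v t - u t))%:E <= 0)%E].

(* Phi P p tau xtau y is the set of values at y of the optimality map of the
   problem on [tau, horizon P] with initial state xtau. *)
Definition Phi (R : realType) (l n m : nat) (P : problem R l n m)
    (p : R -> 'rV[R]_l) (tau : R) (xtau : 'rV[R]_n) (y : Ypoint R n m) :
    set (Zpoint R n m) :=
  let x := yx y in let lam := ylam y in let u := yu y in
  [set z |
    [/\ ae_itv tau (horizon P) (fun t =>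
          zxi z t = - derive1 x t + dyn P (p t) (x t) (u t)),
        znu z = x tau - xtau,
        ae_itv tau (horizon P) (fun t =>
          zeta z t = derive1 lam t + grad_x_H P (p t) (x t) (lam t) (u t)),
        zpi z = lam (horizon P) - grad (term P) (x (horizon P)) &
        exists2 w, normal_cone P tau u w &
          ae_itv tau (horizon P) (fun t =>
            zrho z t = grad_u_H P (p t) (x t) (lam t) (u t) + w t)]].

(* The last clause is the necessity of the optimality system for local
   optimality. *)
Definition standing (R : realType) (l n m : nat) (P : problem R l n m) :
    Prop :=
  [/\ 0 < horizon P,
      forall p, params P p ->
        lebesgue_measurable 0 (horizon P) p /\
        (exists M : R, forall t, t \in `[0, horizon P] -> enorm (p t) <= M) &
      forall p tau xtau x u, params P p -> 0 <= tau < horizon P ->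
        optimal_solution P p tau xtau x u ->
        exists2 lam, abs_continuous tau (horizon P) lam &
          Phi P p tau xtau (YPoint x lam u) (Zzero R n m)].

(* The terminal cost is seen as a function of (p, x) that is constant in p. *)
Definition assumption_A1 (R : realType) (l n m : nat) (P : problem R l n m)
    (L : R) : Prop :=
  [/\ convex_set (ctrlset P), compact (ctrlset P),
      twice_diff_lipschitz L
        (fun (p : 'rV[R]_l) (w : 'rV[R]_n * 'rV[R]_m) => dyn P p w.1 w.2),
      twice_diff_lipschitz L
        (fun (p : 'rV[R]_l) (w : 'rV[R]_n * 'rV[R]_m) =>
           run P p w.1 w.2 : R^o) &
      twice_diff_lipschitz L
        (fun (_ : 'rV[R]_l) (x : 'rV[R]_n) => term P x : R^o)].

Definition assumption_A2 (R : realType) (l n m : nat) (P : problem R l n m) :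
    Prop :=
  (forall u x0 p, controls P 0 u -> params P p ->
     exists x, trajectory P p 0 x0 x u) /\
  (forall tau xtau p, 0 <= tau < horizon P -> params P p ->
     exists x u, optimal_solution P p tau xtau x u).

Definition affine_in_control (R : realType) (l n m : nat)
    (P : problem R l n m) : Prop :=
  forall p x,
    (exists (a : 'rV[R]_n) (B : 'M[R]_(m, n)),
       forall u, dyn P p x u = a + u *m B) /\
    (exists (c : R) (b : 'rV[R]_m), forall u, run P p x u = c + dot b u).

Definition switching (R : realType) (l n m : nat) (P : problem R l n m)
    (p : R -> 'rV[R]_l) (y : Ypoint R n m) (t : R) : 'rV[R]_m :=
  grad_u_H P (p t) (yx y t) (ylam y t) (yu y t).

Definition assumption_C1 (R : realType) (m : nat) (T : R)
    (U : set 'rV[R]_m) (sigma : R -> 'rV[R]_m) : Prop :=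
  exists eta0 mu0 : R, [/\ 0 < eta0, 0 < mu0 &
    forall e s, edge_directions U e -> s \in `[0, T] -> dot (sigma s) e = 0 ->
      forall t, t \in `[s - eta0, s + eta0] -> t \in `[0, T] ->
        mu0 * `|t - s| <= `|dot (sigma t) e|].

Definition switching_points (R : realType) (m : nat) (T : R)
    (U : set 'rV[R]_m) (sigma : R -> 'rV[R]_m) : set R :=
  [set s | s \in `[0, T] /\
           exists2 e, edge_directions U e & dot (sigma s) e = 0].

(* dnear localizes y around yhat, dest is the metric that is estimated. *)
Definition strongly_subregular (R : realType) (A B : Type)
    (Y : set A) (Z : set B) (dnear dest : A -> A -> \bar R)
    (normZ : B -> \bar R) (F : A -> set B) (yhat : A) : Prop :=
  exists alpha beta kappa : R,
    [/\ 0 < alpha, 0 < beta, 0 < kappa &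
      forall y z, Y y -> (dnear y yhat <= alpha%:E)%E ->
        Z z -> F y z -> (normZ z <= beta%:E)%E ->
        (dest y yhat <= kappa%:E * normZ z)%E].

(* Main.v *)
From HB Require Import structures.
Require Import Defs.
From mathcomp Require Import all_boot all_order all_algebra finmap.
From mathcomp Require Import all_classical all_reals all_analysis.
From mathcomp Require Import measurable_realfun ess_sup_inf ring lra.

(** Write H(p, x, lambda, u) for the Hamiltonian and sigma for its gradient in
    u along a triple (x, lambda, u).  The direction from d* to d is a
    comparison of metrics: the set Gamma is finite, so its eps-neighbourhood has
    measure of order eps, controls take their values in a bounded set, and the
    L1-distance of two controls is at most a constant times d* (lemmas
    Lpnorm1_off_finite and subregular_of_star).

    For the converse, let z belong to the image of y = (x, lambda, u) and put
    r = ||z||.  Sub-regularity in d gives ||lambda - lambdahat|| = O(r) in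
    W^{1,1}, hence uniformly.  The Lipschitz assumption holds on the whole
    space, in particular for arbitrarily large u, so that in an affine problem
    the coefficients of u in f and g are constants (grad_u_H_affine).  Hence
    sigma = b + lambda B is Lipschitz in lambda alone, and the component rho of
    z moves it further by at most r: the functional sigma(t) - rho(t),
    minimized over U by u(t), differs by O(r) from sigmahat(t), minimized by
    uhat(t). If the minimizers over a polytope of two functionals differ, then
    along some edge e the functionals do not have the same strict sign
    (argmin_change), so |<sigmahat(t), e>| is at most their difference, O(r).
    On the other hand the linear growth at the zeros, together with the
    continuity of sigmahat, bounds |<sigmahat(t), e>| from below by a constant
    times min(eps, 1) when t has distance more than eps from Gamma
    (switching_growth). For r small and eps a large multiple of r the two
    bounds are incompatible, so u = uhat almost everywhere off the eps-
    neighbourhood of Gamma, that is, d*(u, uhat) <= eps (star_of_subregular).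

    Two ingredients are of independent interest.  The uniform bound on lambda
    (W11norm_sup) is the one-dimensional Sobolev inequality; since absolute
    continuity is given in the epsilon-delta form and the norm of W^{1,1} in
    terms of the pointwise derivative, it needs that an absolutely continuous
    function is differentiable almost everywhere and is the integral of its
    derivative (scalar_ac_ftc).  This is obtained by splitting the function into
    two nondecreasing absolutely continuous ones by means of its total
    variation, showing that their Stieltjes measures vanish on Lebesgue null
    sets, and combining the theorems of Radon-Nikodym and of Lebesgue on
    differentiation.  The statement on minimizers is proved by the argument of
    the simplex method, with points and directions selected by having as many
    active constraints as possible; the same description by active constraints
    shows that a polyhedron has finitely many edge directions, which makes
    Gamma finite. *)

Set Implicit Arguments.
Unset Strict Implicit.
Unset Printing Implicit Defensive.

Import Order.TTheory GRing.Theory Num.Theory.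
Import numFieldNormedType.Exports.
Import HBNNSimple.

Local Open Scope classical_set_scope.
Local Open Scope ring_scope.

(** * The Euclidean structure on row vectors *)

Section euclid.
Context {R : realType} {k : nat}.
Implicit Types u v w e : 'rV[R]_k.

Lemma dotC v w : dot v w = dot w v.
Proof. by apply: eq_bigr => i _; rewrite mulrC. Qed.

Lemma dotDr u v w : dot u (v + w) = dot u v + dot u w.
Proof. by rewrite -big_split; apply: eq_bigr => i _; rewrite mxE mulrDr. Qed.

Lemma dotZr c v w : dot v (c *: w) = c * dot v w.
Proof. by rewrite big_distrr; apply: eq_bigr => i _; rewrite mxE /= mulrCA. Qed.

Lemma dotNr v w : dot v (- w) = - dot v w.
Proof. by rewrite -scaleN1r dotZr mulN1r. Qed.

Lemma dotBr u v w : dot u (v - w) = dot u v - dot u w.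
Proof. by rewrite dotDr dotNr. Qed.

Lemma dot0r v : dot v 0 = 0.
Proof. by rewrite -(scale0r 0) dotZr mul0r. Qed.

Lemma dotDl u v w : dot (u + v) w = dot u w + dot v w.
Proof. by rewrite dotC dotDr !(dotC w). Qed.

Lemma dotNl v w : dot (- v) w = - dot v w.
Proof. by rewrite dotC dotNr dotC. Qed.

Lemma dotBl u v w : dot (u - v) w = dot u w - dot v w.
Proof. by rewrite dotDl dotNl. Qed.

Lemma dot_suml (I : finType) (A : {set I}) (F : I -> 'rV[R]_k) w :
  dot (\sum_(i in A) F i) w = \sum_(i in A) dot (F i) w.
Proof.
elim/big_rec2: _ => [|i x y _ <-]; last by rewrite dotDl.
by rewrite dotC dot0r.
Qed.

Lemma enorm_ge0 v : 0 <= enorm v.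
Proof. exact: sqrtr_ge0. Qed.

Lemma enorm_ge_coord v i : `|v ord0 i| <= enorm v.
Proof.
rewrite /enorm /dot -sqrtr_sqr ler_sqrt; last first.
  by apply: sumr_ge0 => j _; rewrite -expr2 sqr_ge0.
rewrite (bigD1 i)//= -expr2 lerDl.
by apply: sumr_ge0 => j _; rewrite -expr2 sqr_ge0.
Qed.

Lemma enormZ c v : enorm (c *: v) = `|c| * enorm v.
Proof.
by rewrite /enorm dotZr dotC dotZr mulrA -expr2 sqrtrM ?sqr_ge0// sqrtr_sqr.
Qed.

Lemma enorm_gt0 v : v != 0 -> 0 < enorm v.
Proof.
move=> v0; have [i vi] : exists i, v ord0 i != 0.
  apply/existsP; apply: contraNT v0; rewrite negb_exists => /forallP v0.
  by apply/eqP/rowP => i; rewrite mxE; have := v0 i; rewrite negbK => /eqP.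
by apply: lt_le_trans (enorm_ge_coord v i); rewrite normr_gt0.
Qed.

Lemma enorm_le_sum v : enorm v <= \sum_i `|v ord0 i|.
Proof.
have s0 : 0 <= \sum_i `|v ord0 i| by apply: sumr_ge0.
rewrite /enorm -[leRHS]ger0_norm// -sqrtr_sqr ler_sqrt ?sqr_ge0//.
rewrite expr2 mulr_suml; apply: ler_sum => i _.
apply: le_trans (ler_norm _) _; rewrite normrM ler_wpM2l//.
by rewrite (bigD1 i)//= lerDl sumr_ge0.
Qed.

Lemma dot_le_sum v e : enorm e = 1 -> `|dot v e| <= \sum_i `|v ord0 i|.
Proof.
move=> e1; apply: le_trans (ler_norm_sum _ _ _) _; apply: ler_sum => i _.
by rewrite normrM ler_piMr// -e1 enorm_ge_coord.
Qed.

Lemma norm_coord_le v j : `|v ord0 j| <= `|v|.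
Proof.
rewrite [leRHS]/Num.Def.normr/= mx_normrE.
by apply: le_trans (le_bigmax _ _ (ord0, j)).
Qed.

Lemma compact_coord_bounded (U : set 'rV[R]_k) :
  compact U -> exists2 M : R, 0 <= M & forall v i, U v -> `|v ord0 i| <= M.
Proof.
move=> /compact_bounded[M [_ HM]]; exists (Num.max M 0 + 1).
  by rewrite addr_ge0// le_max lexx orbT.
move=> v i Uv; apply: le_trans (norm_coord_le _ _) _; apply: HM Uv.
by rewrite ltr_pwDr// le_max lexx.
Qed.

End euclid.

Lemma dot_mulmx (R : realType) n m (lam : 'rV[R]_n) (u : 'rV[R]_m) (B : 'M[R]_(m, n)) :
  dot lam (u *m B) = dot (lam *m B^T) u.
Proof.
have dotE k (v w : 'rV[R]_k) : dot v w = (v *m w^T) ord0 ord0.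
  by rewrite mxE; apply: eq_bigr => i _; rewrite mxE.
by rewrite !dotE trmx_mul mulmxA.
Qed.

(** * Absolutely continuous functions of one variable *)

Section scalar_ac.
Context {R : realType}.
Implicit Types (a b s t eps : R) (f g : R -> R).
Local Notation mu := (@lebesgue_measure R).
Local Notation LS := (@lebesgue_stieltjes_measure R).

(** The intervals are indexed by an arbitrary finite type, so that the pieces of
    a family of partitioned intervals can be indexed by pairs. *)
Definition scalar_ac a b f : Prop :=
  forall eps : R, 0 < eps -> exists2 delta : R, 0 < delta &
    forall (I : finType) (s t : I -> R),
      (forall i, [/\ a <= s i, s i <= t i & t i <= b]) ->
      trivIset setT (fun i => `]s i, t i[%classic) ->
      \sum_i (t i - s i) < delta ->
      \sum_i `|f (t i) - f (s i)| < eps.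

Lemma abs_continuous_scalar k a b (x : R -> 'rV[R]_k) f C : 0 < C ->
  (forall s t, `|f t - f s| <= C * enorm (x t - x s)) ->
  abs_continuous a b x -> scalar_ac a b f.
Proof.
move=> C0 fx acx eps eps0.
have /acx[d d0 H] : 0 < eps / C by rewrite divr_gt0.
exists d => // I s t st tr sumlt.
pose ev := @enum_val I predT.
have tr' : trivIset setT (fun i => `](s \o ev) i, (t \o ev) i[%classic).
  by move=> j j' _ _ /(tr (ev j) (ev j') Logic.I Logic.I)/enum_val_inj.
have bij := onW_bij predT (@enum_val_bij I).
rewrite (reindex _ bij) in sumlt.
have := H _ (s \o ev) (t \o ev) (fun i => st _) tr' sumlt.
rewrite ltr_pdivlMr// mulr_suml (reindex _ bij) /=; apply: le_lt_trans.
by apply: ler_sum => j _; rewrite mulrC.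
Qed.

Lemma abs_continuous_coord k a b (x : R -> 'rV[R]_k) i :
  abs_continuous a b x -> scalar_ac a b (fun t => x t ord0 i).
Proof.
apply: (@abs_continuous_scalar _ _ _ _ _ 1) => // s t.
by rewrite mul1r; apply: le_trans (enorm_ge_coord _ i); rewrite !mxE.
Qed.

Lemma scalar_acS a b s t f : a <= s -> t <= b ->
  scalar_ac a b f -> scalar_ac s t f.
Proof.
move=> as_ tb acf e /acf[d d0 H]; exists d => // I u v uv tr; apply: H => // i.
by have [? ? ?] := uv i; split => //; [exact: le_trans as_ _|exact: le_trans tb].
Qed.

Lemma scalar_acB a b f g : scalar_ac a b f -> scalar_ac a b g ->
  scalar_ac a b (f \- g).
Proof.
move=> acf acg e e0; have e2 : 0 < e / 2 by rewrite divr_gt0.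
have [d d0 H] := acf _ e2; have [d' d0' H'] := acg _ e2.
exists (Num.min d d'); first by rewrite lt_min d0.
move=> I s t st tr; rewrite lt_min => /andP[/(H _ _ _ st tr) h /(H' _ _ _ st tr) h'].
rewrite (splitr e); apply: le_lt_trans (ltrD h h').
rewrite -big_split /=; apply: ler_sum => i _.
rewrite [X in `|X|](_ : _ = (f (t i) - f (s i)) - (g (t i) - g (s i))); last by ring.
exact: ler_normB.
Qed.

Lemma scalar_ac_unif_continuous a b f : scalar_ac a b f ->
  forall eps, 0 < eps -> exists2 d, 0 < d &
    forall s t, a <= s -> s <= t -> t <= b -> t - s < d -> `|f t - f s| < eps.
Proof.
move=> acf eps /acf[d d0 H]; exists d => // s t as_ st tb tsd.
have := H unit (fun=> s) (fun=> t).
rewrite !big_const !card_unit /= !addr0; apply=> //.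
by move=> [] [].
Qed.

(** The pieces of a disjoint family of partitioned intervals form again a
    disjoint family, of the same total length. *)
Lemma scalar_ac_variation a b f : scalar_ac a b f ->
  forall eps : R, 0 < eps -> exists2 delta : R, 0 < delta &
    forall (I : finType) (s t : I -> R) (l : I -> seq R),
      (forall i, a <= s i /\ t i <= b) ->
      (forall i, itv_partition (s i) (t i) (l i)) ->
      trivIset setT (fun i => `]s i, t i[%classic) ->
      \sum_i (t i - s i) < delta ->
      \sum_i variation (s i) (t i) f (l i) < eps.
Proof.
move=> acf eps /acf[d d0 H]; exists d => // I s t l st lst tr ltd.
pose F i k := nth (t i) (s i :: l i) k.
pose J := {i : I & 'I_(size (l i))}.
pose s' (p : J) := F (tag p) (tagged p).
pose t' (p : J) := F (tag p) (tagged p).+1.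
have Fge i k : (k <= size (l i))%N -> s i <= F i k.
  by move=> kl; exact: itv_partition_nth_ge (lst i).
have Fle i k : (k <= size (l i))%N -> F i k <= t i.
  by move=> kl; exact: itv_partition_nth_le (lst i).
have srt i : sorted <=%O (s i :: l i).
  by have [+ _] := lst i; apply: sub_path => u v /ltW.
have Fmon i j k : (j <= k)%N -> (k <= size (l i))%N -> F i j <= F i k.
  move=> jk kl; apply: (sorted_leq_nth le_trans (@lexx _ _) _ (srt i)) => //.
  by rewrite inE/= ltnS (leq_trans jk).
have -> : \sum_i variation (s i) (t i) f (l i) =
    \sum_(p : J) `|f (t' p) - f (s' p)|.
  rewrite (eq_bigr (fun i => \sum_(k < size (l i)) `|f (F i k.+1) - f (F i k)|)).
    by rewrite sig_big_dep.
  by move=> i _; rewrite /variation big_mkord.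
apply: H.
- move=> [i k]; rewrite /s' /t' /=; have [as_ tb] := st i; split.
  + by apply: le_trans as_ (Fge _ _ _); apply: ltnW.
  + exact: Fmon.
  + by apply: le_trans tb; apply: Fle.
- move=> [i j] [i' j'] _ _ [x []]; rewrite /s' /t' /= !in_itv /=.
  move=> /andP[x1 x2] /andP[x3 x4].
  have ii : i = i'.
    apply: tr => //; exists x; split; rewrite /= in_itv /=; apply/andP; split.
    + by apply: le_lt_trans x1; apply/Fge/ltnW.
    + by apply: lt_le_trans x2 _; apply/Fle.
    + by apply: le_lt_trans x3; apply/Fge/ltnW.
    + by apply: lt_le_trans x4 _; apply/Fle.
  subst i'; congr existT; apply/val_inj/eqP => /=.
  rewrite eqn_leq; apply/andP; split; rewrite leqNgt; apply/negP => jj.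
    have := lt_trans x1 (lt_le_trans x4 (Fmon i _ _ jj (ltnW (ltn_ord _)))).
    by rewrite ltxx.
  have := lt_trans x3 (lt_le_trans x2 (Fmon i _ _ jj (ltnW (ltn_ord _)))).
  by rewrite ltxx.
- suff -> : \sum_(p : J) (t' p - s' p) = \sum_i (t i - s i) by [].
  rewrite -(@sig_big_dep _ _ _ _ (fun i => 'I_(size (l i))) xpredT (fun _ _ => true)
    (fun i k => F i k.+1 - F i k)).
  apply: eq_bigr => i _.
  rewrite -(big_mkord xpredT (fun k => F i k.+1 - F i k)) telescope_sumr//.
  by rewrite {1}/F (itv_partition_nth_size _ (lst i)).
Qed.

(** Intervals shorter than some delta have variation at most 1, and finitely many
    steps of length delta / 2 exhaust the interval. *)
Lemma scalar_ac_bounded_variation a b f : a <= b -> scalar_ac a b f ->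
  bounded_variation a b f.
Proof.
move=> ab acf.
have [d d0 H] := scalar_ac_variation acf ltr01.
have small x y : a <= x -> x <= y -> y <= b -> y - x < d ->
    bounded_variation x y f.
  move=> ax xy yb yxd; exists 1 => _ [l pl <-].
  have := H unit (fun=> x) (fun=> y) (fun=> l).
  rewrite !big_const !card_unit /= !addr0 => h; apply/ltW/h => //.
  by move=> [] [].
have step k : forall x, a <= x <= b -> x - a < d / 2 * k.+1%:R -> bounded_variation a x f.
  elim: k => [|k ih] x /andP[ax xb] xk.
    by apply: small => //; apply: lt_trans xk _; rewrite mulr1 ltr_pdivrMr// ltr_pMr// ltr1n.
  have [xs|xl] := ltP (x - a) (d / 2 * k.+1%:R); first by apply: ih => //; rewrite ax.
  set y := Num.max a (x - d / 2).
  have ay : a <= y by rewrite le_max lexx.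
  have yx : y <= x by rewrite ge_max ax/= gerBl divr_ge0// ltW.
  apply/bounded_variationP => //; rewrite (total_variationD f ay yx) fin_numD.
  apply/andP; split; apply/bounded_variationP => //.
    apply: ih; first by rewrite ay (le_trans yx).
    rewrite /y; case: (leP a (x - d / 2)) => h.
      move: xk; rewrite -[k.+2]addn1 natrD mulrDr mulr1; lra.
    by rewrite subrr mulr_gt0// divr_gt0.
  apply: small => //.
  have : x - d / 2 <= y by rewrite le_max lexx orbT.
  lra.
pose k := Num.truncn ((b - a) / (d / 2)).
apply: (step k); first by rewrite ab lexx.
by rewrite mulrC -ltr_pdivrMr ?divr_gt0// /k truncnS_gt.
Qed.

(** The total variations over a disjoint family are almost attained by
    partitions, and the partitions together form one disjoint family. *)
Lemma scalar_ac_total_variation a b f : a <= b -> scalar_ac a b f ->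
  scalar_ac a b (fun x => fine (total_variation a x f)).
Proof.
move=> ab acf eps eps0.
have bv := scalar_ac_bounded_variation ab acf.
have e2 : 0 < eps / 2 by rewrite divr_gt0.
have [d d0 H] := scalar_ac_variation acf e2; exists d => // I s t st tr ltd.
have bvi i : bounded_variation (s i) (t i) f.
  have [as_ st' tb] := st i.
  apply: (bounded_variationl st' tb).
  by apply: (bounded_variationr as_ _ bv); exact: le_trans tb.
have fini i : total_variation (s i) (t i) f \is a fin_num.
  by have [_ st' _] := st i; apply/bounded_variationP.
have TVE i : `|fine (total_variation a (t i) f) - fine (total_variation a (s i) f)|
    = fine (total_variation (s i) (t i) f).
  have [as_ st' tb] := st i.
  rewrite (total_variationD f as_ st') fineD//; last first.
    apply/bounded_variationP => //; apply: bounded_variationl bv => //.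
    exact: le_trans tb.
  by rewrite addrAC subrr add0r ger0_norm// fine_ge0// total_variation_ge0.
under eq_bigr do rewrite TVE.
apply: (@le_lt_trans _ _ (eps / 2)); last by rewrite ltr_pdivrMr// ltr_pMr// ltr1n.
apply/ler_addgt0Pr => e e0.
(* the error allowed in each of the intervals, e in total *)
pose eta := e / (#|I|.+1)%:R.
have eta0 : 0 < eta by rewrite divr_gt0// ltr0n.
have ex i : {l | itv_partition (s i) (t i) l &
    fine (total_variation (s i) (t i) f) - eta <= variation (s i) (t i) f l}.
  apply/cid2.
  have [_ [r [l lp <-] <-] lt] := ub_ereal_sup_adherent eta0 (fini i).
  exists l => //; rewrite -lee_fin EFinB fineK//; exact: ltW.
pose l i := s2val (ex i).
apply: (@le_trans _ _ (\sum_i (variation (s i) (t i) f (l i) + eta))).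
  by apply: ler_sum => i _; rewrite -lerBlDr /l; case: (ex i).
rewrite big_split /= lerD//; first last.
  rewrite sumr_const -mulr_natr /eta -mulrA ler_piMr ?(ltW e0)//.
  by rewrite mulrC ler_pdivrMr ?ltr0n// mul1r ler_nat.
apply/ltW/H => // i; first by have [? ? ?] := st i.
by rewrite /l; case: (ex i).
Qed.

(** * The Stieltjes measure of an absolutely continuous function *)

Definition clamp a b x : R := Num.max a (Num.min x b).

Lemma clamp_itv a b x : a <= b -> a <= clamp a b x <= b.
Proof. by move=> ab; rewrite /clamp le_max lexx ge_max ab ge_min lexx orbT. Qed.

Lemma clamp_id a b x : a <= x <= b -> clamp a b x = x.
Proof. by move=> /andP[ax xb]; rewrite /clamp (min_idPl xb) (max_idPr ax). Qed.

Lemma clamp_le a b x y : x <= y -> clamp a b x <= clamp a b y.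
Proof.
move=> xy; rewrite /clamp ge_max le_max lexx/= le_max; apply/orP; right.
by rewrite le_min !ge_min xy lexx orbT.
Qed.

Lemma clamp_shorten a b x y : x <= y -> clamp a b y - clamp a b x <= y - x.
Proof.
move=> xy; rewrite /clamp.
by case: (leP x b) => ?; case: (leP y b) => ?; case: (leP a x) => ?; case: (leP a y) => ?; case: (leP a b) => ?; lra.
Qed.

Lemma clamp_oo a b x y : a <= b ->
  `]clamp a b x, clamp a b y[%classic `<=` `]x, y].
Proof.
move=> ab z; rewrite /= !in_itv/= /clamp gt_max lt_max gt_min lt_min.
case/andP => /andP[az /orP xz] /orP[za|/andP[zy zb]].
  by have := lt_trans az za; rewrite ltxx.
rewrite (ltW zy) andbT; case: xz => // bz.
by have := lt_trans bz zb; rewrite ltxx.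
Qed.

Lemma clamp_cumulative a b g : a <= b -> scalar_ac a b g ->
  {in `[a, b] &, nondecreasing_fun g} ->
  exists G : cumulative R R, forall x, G x = g (clamp a b x).
Proof.
move=> ab acg ndg.
have nd : nondecreasing (g \o clamp a b).
  by move=> x y xy /=; apply: ndg; rewrite ?in_itv/= ?clamp_itv//; exact: clamp_le.
have rc : right_continuous (g \o clamp a b).
  move=> x; apply/(@cvgrPdist_lt _ R^o) => /= e e0.
  have [d d0 H] := scalar_ac_unif_continuous acg e0.
  near=> y.
  have xy : x <= y by near: y; exact: nbhs_right_ge.
  rewrite distrC; apply: H.
  - by have /andP[] := clamp_itv x ab.
  - exact: clamp_le.
  - by have /andP[] := clamp_itv y ab.
  - apply: le_lt_trans (clamp_shorten _ _ xy) _.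
    by rewrite ltrBlDl; near: y; apply: nbhs_right_lt; rewrite ltrDl.
pose G : cumulative R R :=
  HB.pack (g \o clamp a b) (isCumulative.Build R _ R (g \o clamp a b) nd rc).
by exists G.
Unshelve. all: by end_near. Qed.

Lemma lebesgue_stieltjes_ocitv (G : cumulative R R) (s t : R) : s <= t ->
  LS G `]s, t] = (G t - G s)%:E.
Proof.
move=> st; rewrite /lebesgue_stieltjes_measure /measure_extension/=.
rewrite measurable_mu_extE/=; last exact: is_ocitv.
by rewrite wlength_itv_bnd.
Qed.

(** Finite unions of half-open intervals decompose into disjoint ones, to which
    absolute continuity applies once they are cut to the interval [a, b]. *)
Lemma stieltjes_small_ring a b g (G : cumulative R R) (eps : R) : a <= b ->
  scalar_ac a b g -> {in `[a, b] &, nondecreasing_fun g} ->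
  (forall x, G x = g (clamp a b x)) -> 0 < eps ->
  exists2 d : R, 0 < d & forall A : set R, 
      measurable (A : set (SetRing.type (ocitv_type R))) ->
    (mu A < d%:E)%E -> (LS G A <= eps%:E)%E.
Proof.
move=> ab acg ndg GE /acg[d d0 H]; exists d => // A /SetRing.ring_finite_set[B].
move=> [Bfin B0 Btriv Bm ->] ltd.
have Bm' X : B X -> R.-ocitv.-measurable X by move=> BX; apply: Bm; rewrite inE.
have BM X : B X -> measurable (X : set (measurableTypeR R)).
  by move=> /Bm'; exact: sub_sigma_algebra.
pose F := fset_set B.
have FB (X : F) : B (val X) by have := valP X; rewrite in_fset_set// inE.
have bnd (X : F) : {x : R * R | x.1 < x.2 & val X = `]x.1, x.2]%classic}.
  apply/cid2; have /Bm'/ocitvP[X0|//] := FB X.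
  by have := B0 _ (FB X); rewrite X0 => -[].
have sumE (nu : {measure set (measurableTypeR R) -> \bar R}) :
    nu (\bigcup_(X in B) X) = (\sum_(X : F) nu (val X))%E.
  rewrite measure_fin_bigcup// fsbig_finite//=.
  by rewrite -(big_seq_fsetE _ _ xpredT (fun X => nu X)).
move: ltd; rewrite !sumE => ltd.
pose s (X : F) := clamp a b (s2val (bnd X)).1.
pose t (X : F) := clamp a b (s2val (bnd X)).2.
have muE (X : F) : mu (val X) = ((s2val (bnd X)).2 - (s2val (bnd X)).1)%:E.
  case: (bnd X) => -[u v] /= uv ->.
  by rewrite /lebesgue_measure lebesgue_stieltjes_ocitv// ltW.
have nuE (X : F) : LS G (val X) = (`|g (t X) - g (s X)|)%:E.
  rewrite /t /s; case: (bnd X) => -[u v] /= uv ->.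
  rewrite lebesgue_stieltjes_ocitv ?(ltW uv)// !GE ger0_norm// subr_ge0.
  have uv' := clamp_le a b (ltW uv).
  by apply: ndg; rewrite ?in_itv/= ?clamp_itv.
rewrite (eq_bigr _ (fun X _ => nuE X)) sumEFin lee_fin; apply/ltW/H.
- move=> X; rewrite /s /t; case: (bnd X) => -[u v] /= uv _.
  have /andP[? ?] := clamp_itv u ab; have /andP[? ?] := clamp_itv v ab.
  by split => //; exact/clamp_le/ltW.
- move=> X Y _ _ [x [Xx Yx]]; apply: val_inj; apply: Btriv => //.
  exists x; split.
    by move: Xx; rewrite /s /t; case: (bnd X) => -[u v] /= uv -> /clamp_oo; apply.
  by move: Yx; rewrite /s /t; case: (bnd Y) => -[u v] /= uv -> /clamp_oo; apply.
- move: ltd; rewrite (eq_bigr _ (fun X _ => muE X)) sumEFin lte_fin.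
  apply: le_lt_trans; apply: ler_sum => X _; rewrite /s /t.
  by case: (bnd X) => -[u v] /= uv _; rewrite clamp_shorten// ltW.
Qed.

(** A Lebesgue null set is covered by countably many half-open intervals of small
    total length; the finite partial unions have small Stieltjes measure, hence
    so has their increasing union. *)
Lemma stieltjes_null a b g (G : cumulative R R) (A : set R) : a <= b ->
  scalar_ac a b g -> {in `[a, b] &, nondecreasing_fun g} ->
  (forall x, G x = g (clamp a b x)) -> measurable A -> mu A = 0%E ->
  LS G A = 0%E.
Proof.
move=> ab acg ndg GE mA A0; apply/eqP; rewrite eq_le measure_ge0 andbT.
apply/lee_addgt0Pr => e e0; rewrite add0e.
have [d d0 H] := stieltjes_small_ring ab acg ndg GE e0.
have : (mu A < d%:E)%E by rewrite A0 lte_fin.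
move=> /ereal_inf_lt[z [/= M [Mm AM] <-] Md].
pose U n := \big[setU/set0]_(k < n.+1) M k.
have MM k : measurable (M k : set (measurableTypeR R)).
  by apply: sub_sigma_algebra; exact: Mm.
have mU n : measurable (U n : set (measurableTypeR R)).
  by apply: bigsetU_measurable => k _.
have UM : \bigcup_n U n = \bigcup_n M n.
  exact: bigcup_bigsetU_bigcup.
apply: (@le_trans _ _ (LS G (\bigcup_n M n))).
  by apply: le_measure; rewrite ?inE//; apply: bigcup_measurable => n _; exact: MM.
rewrite -UM.
have ndU : nondecreasing_seq U.
  by move=> m n mn; apply/subsetPset; exact: subset_bigsetU.
have mUU : measurable (\bigcup_n U n : set (measurableTypeR R)).
  by apply: bigcup_measurable => n _; exact: mU.
have cv := nondecreasing_cvg_mu mU mUU ndU.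
rewrite -(cvg_lim _ (cv _ (LS G)))//.
apply: lime_le; first by apply/cvg_ex; eexists; exact: cv.
apply: nearW => n /=; apply: H.
  apply: bigsetU_measurable => k _; exact: SetRing.measurable_subring.
apply: le_lt_trans Md.
apply: (@le_trans _ _ (\sum_(k < n.+1) mu (M k))%E).
  exact: Boole_inequality.
have -> : (\sum_(k <oo) wlength idfun (M k) = \sum_(k <oo) mu (M k))%E.
  apply: eq_eseriesr => k _; rewrite /lebesgue_measure /lebesgue_stieltjes_measure.
  by rewrite /measure_extension/= measurable_mu_extE.
rewrite -(big_mkord xpredT (fun k => mu (M k))).
exact: nneseries_lim_ge.
Qed.

(** The density is the Radon-Nikodym derivative of the Stieltjes measure,
    restricted to the interval to make it finite. *)
Lemma nondecreasing_ac_density a b g : a <= b -> scalar_ac a b g ->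
  {in `[a, b] &, nondecreasing_fun g} ->
  exists2 h : R -> R, mu.-integrable setT (EFin \o h) &
    forall t, a <= t <= b ->
      (g t - g a)%:E = (\int[mu]_(x in `]a, t]) (h x)%:E)%E.
Proof.
move=> ab acg ndg; have [G GE] := clamp_cumulative ab acg ndg.
have mD : measurable (`]a, b]%classic : set (measurableTypeR R)).
  exact: measurable_itv.
have nuD : (LS G `]a, b] < +oo)%E by rewrite lebesgue_stieltjes_ocitv// ltry.
pose nu : {finite_measure set (measurableTypeR R) -> \bar R} := mfrestr mD nuD.
have dom : nu `<< mu.
  move=> A A0 B mB BA.
  have B0 := A0 B mB BA.
  apply/eqP; rewrite eq_le measure_ge0 andbT.
  rewrite -(stieltjes_null ab acg ndg GE mB B0).
  by apply: le_measure; rewrite ?inE//; exact: measurableI.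
have [f [f0 ffin fint fE]] := radon_nikodym_sigma_finite dom.
exists (fine \o f).
  by apply: eq_integrable fint => // x _ /=; rewrite fineK.
move=> t /andP[at_ tb]; under eq_integral do rewrite fineK//.
rewrite -fE; last exact: measurable_itv.
rewrite /nu /= /mfrestr /mrestr setIidl; last first.
  by move=> x /=; rewrite !in_itv /= => /andP[-> /le_trans]; apply.
by rewrite lebesgue_stieltjes_ocitv// !GE !clamp_id// ?at_ ?tb ?lexx.
Qed.

(** The total variation V and the difference V - f are nondecreasing and
    absolutely continuous, so both have a density. *)
Lemma scalar_ac_density a b f : a <= b -> scalar_ac a b f ->
  exists2 h : R -> R, mu.-integrable setT (EFin \o h) &
    forall t, a <= t <= b ->
      (f t - f a)%:E = (\int[mu]_(x in `]a, t]) (h x)%:E)%E.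
Proof.
move=> ab acf; have bv := scalar_ac_bounded_variation ab acf.
set V := fun x => fine (total_variation a x f).
have acV : scalar_ac a b V by exact: scalar_ac_total_variation.
have VD x y : a <= x -> x <= y -> y <= b -> `|f y - f x| <= V y - V x.
  move=> ax xy yb; rewrite /V (total_variationD f ax xy) fineD; last 2 first.
    by apply/bounded_variationP => //; apply: bounded_variationl bv => //; exact: le_trans yb.
    apply/bounded_variationP => //; apply: (bounded_variationl xy yb).
    by apply: (bounded_variationr ax _ bv); exact: le_trans yb.
  rewrite addrAC subrr add0r -lee_fin fineK ?total_variation_ge//.
  apply/bounded_variationP => //; apply: (bounded_variationl xy yb).
  by apply: (bounded_variationr ax _ bv); exact: le_trans yb.
have ndV : {in `[a, b] &, nondecreasing_fun V}.
  move=> x y; rewrite !in_itv/= => /andP[ax xb] /andP[ay yb] xy.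
  by rewrite -subr_ge0; apply: le_trans (VD _ _ ax xy yb).
have ndW : {in `[a, b] &, nondecreasing_fun (V \- f)}.
  move=> x y; rewrite !in_itv/= => /andP[ax xb] /andP[ay yb] xy.
  have := le_trans (ler_norm _) (VD _ _ ax xy yb); lra.
have [h ih hE] := nondecreasing_ac_density ab acV ndV.
have [k ik kE] := nondecreasing_ac_density ab (scalar_acB acV acf) ndW.
exists (h \- k).
  by apply: eq_integrable (integrableB _ ih ik).
move=> t abt; under eq_integral do rewrite EFinB.
rewrite integralB//=; last 2 first.
  by apply: integrableS ih.
  by apply: integrableS ik.
rewrite -hE// -kE//= -EFinB; congr (_%:E); ring.
Qed.

(** Lebesgue differentiation of the indefinite integral of the density. *)
Lemma scalar_ac_ftc a b f : a <= b -> scalar_ac a b f ->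
  exists h : R -> R, [/\ mu.-integrable setT (EFin \o h),
    forall t, a <= t <= b -> f t - f a = Rintegral mu `]a, t] h &
    {ae mu, forall t, a < t < b -> is_derive t (1 : R) f (h t)}].
Proof.
move=> ab acf; have [h ih hE] := scalar_ac_density ab acf.
have fE t : a <= t <= b -> f t - f a = Rintegral mu `]a, t] h.
  by move=> abt; rewrite /Rintegral -hE.
exists h; split => //.
have locf : locally_integrable setT h.
  by apply: open_integrable_locally => //; exact: openT.
have intf y : mu.-integrable [set` Interval (BRight a) (BRight y)] (EFin \o h).
  by apply: integrableS ih.
have := FTC1 intf locf.
apply: filterS; first exact: (ae_filter_ringOfSetsType mu).
move=> x Hx /andP[ax xb].
have [|dF FE] := Hx; first by rewrite lte_fin.
set F := fun y => (\int[mu]_(t in `]a, y]) h t)%R.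
have isd : is_derive x (1 : R) F (h x).
  by apply: DeriveDef; [exact: dF|rewrite -derive1E; exact: FE].
have isd' : is_derive x (1 : R) (F \+ cst (f a)) (h x).
  by apply: is_derive_eq; rewrite addr0.
apply: near_eq_is_derive isd'.
near=> y; rewrite /F /= -fE ?subrK//.
apply/andP; split; apply: ltW; near: y.
  exact: lt_nbhsr.
exact: lt_nbhsl.
Unshelve. all: by end_near. Qed.

End scalar_ac.

(** * Norms of vector functions and the Sobolev inequality *)

Section sobolev.
Context {R : realType}.
Local Notation mu := (@lebesgue_measure R).

(** The integral of a nonnegative function is the supremum of the integrals of
    the simple functions below it, so it is monotone without any measurability;
    an exceptional null set is cut out of the simple functions. *)
Lemma ge0_ae_le_integral (f1 f2 : R -> \bar R) :
  (forall x, 0 <= f1 x)%E -> (forall x, 0 <= f2 x)%E ->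
  {ae mu, forall x, (f1 x <= f2 x)%E} ->
  (\int[mu]_x f1 x <= \int[mu]_x f2 x)%E.
Proof.
move=> f10 f20 [N [mN N0 subN]].
have mNC : measurable (~` N) by exact: measurableC.
rewrite [leLHS]ge0_integralTE//; apply: ge_ereal_sup => _ [h hf <-].
rewrite -integralT_nnsfun (ge0_negligible_integral mN)//; last 2 first.
- by apply/measurable_EFinP; exact: measurable_funP.
- by move=> x _; rewrite lee_fin fun_ge0.
rewrite setTD integral_mkcond.
rewrite !ge0_integralTE//; last first.
  by move=> x; rewrite patchE; case: ifP => // _; rewrite lee_fin fun_ge0.
apply: le_ereal_sup => _ [g gh <-]; exists g => // x.
apply: le_trans (gh x) _; rewrite patchE; case: ifP => // xN.
apply: le_trans (hf x) _.
apply: contrapT => f12; move/set_mem: xN; apply; exact: subN.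
Qed.

Lemma Lpnorm1E k (a b : R) (v : R -> 'rV[R]_k) :
  Lpnorm 1%:E a b v = (\int[mu]_x ((fun t => (enorm (v t))%:E) \_ `[a, b]) x)%E.
Proof.
rewrite /Lpnorm Lnorm1; apply: eq_integral => x _.
by rewrite patchE; case: ifP; rewrite ?abse0// gee0_abs// lee_fin enorm_ge0.
Qed.

Lemma Lpnorm1_le k (a b s t : R) (v : R -> 'rV[R]_k) : a <= s -> t <= b ->
  (Lpnorm 1%:E s t v <= Lpnorm 1%:E a b v)%E.
Proof.
move=> as_ tb; rewrite !Lpnorm1E.
rewrite !ge0_integralTE//; last 2 first.
- by move=> x; rewrite patchE; case: ifP => // _; rewrite lee_fin enorm_ge0.
- by move=> x; rewrite patchE; case: ifP => // _; rewrite lee_fin enorm_ge0.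
apply: le_ereal_sup => _ [h hf <-]; exists h => // x.
apply: le_trans (hf x) _; rewrite !patchE; case: ifPn => [|_]; last first.
  by case: ifP => // _; rewrite lee_fin enorm_ge0.
rewrite inE/= in_itv/= => /andP[sx xt]; rewrite ifT//.
by rewrite inE/= in_itv/= (le_trans as_ sx) (le_trans xt tb).
Qed.

(** Almost everywhere in the interval all coordinates are differentiable, so that
    the pointwise derivative of the vector function has them as coordinates. *)
Lemma abs_continuous_increment k (s t : R) (x : R -> 'rV[R]_k) i : s <= t ->
  (forall j, scalar_ac s t (fun u => x u ord0 j)) ->
  (`|x t ord0 i - x s ord0 i|%:E <= Lpnorm 1%:E s t (derive1 x))%E.
Proof.
move=> st acx.
have /choice[h hP] := fun j => scalar_ac_ftc st (acx j).
have aef := ae_filter_ringOfSetsType mu.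
have der : {ae mu, forall u, s < u < t -> forall j, derive1 x u ord0 j = h j u}.
  have : {ae mu, forall u, forall j, s < u < t ->
      is_derive u (1 : R) (fun u => x u ord0 j) (h j u)}.
    by apply: filter_forall => j; have [_ _] := hP j.
  apply: filterS => u H su j.
  have dx : derivable x u 1.
    by apply/derivable_mxP => i' j'; rewrite (ord1 i'); have [] := H j' su.
  by rewrite derive1E (derive_mx dx) mxE; have [_ ->] := H j su.
have [hi hE _] := hP i.
have mst : measurable (`]s, t]%classic : set (measurableTypeR R)).
  exact: measurable_itv.
have hi' : mu.-integrable `]s, t] (EFin \o h i) by exact: integrableS hi.
rewrite hE ?st ?lexx// -abse_EFin /Rintegral fineK; last exact: integrable_fin_num.
apply: le_trans (le_abse_integral _ _ _) _ => //.
  by have /integrableP[] := hi'.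
rewrite Lpnorm1E integral_mkcond; apply: ge0_ae_le_integral.
- by move=> u; rewrite patchE; case: ifP.
- by move=> u; rewrite patchE; case: ifP => // _; rewrite lee_fin enorm_ge0.
have nt : {ae mu, forall u, u <> t}.
  exists [set t]; split => //; first exact: lebesgue_measure_set1.
  by move=> u /= /contrapT.
apply: filterS2 nt der => u ut H; rewrite !patchE; case: ifPn => [|_]; last first.
  by case: ifP => // _; rewrite lee_fin enorm_ge0.
rewrite inE/= in_itv/= => /andP[su u_t]; rewrite ifT; last first.
  by rewrite inE/= in_itv/= (ltW su).
rewrite lee_fin -H ?enorm_ge_coord// su lt_neqAle u_t andbT.
exact/eqP.
Qed.

(** The oscillation is bounded by the norm of the derivative, and the smallest
    absolute value by the mean. *)
Lemma W11norm_sup k (a b r : R) (x : R -> 'rV[R]_k) i : a < b ->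
  (forall j, scalar_ac a b (fun u => x u ord0 j)) -> (W11norm a b x <= r%:E)%E ->
  forall t, a <= t <= b -> `|x t ord0 i| <= (1 + (b - a)^-1) * r.
Proof.
move=> ab acx xr t /andP[at_ tb].
have n0 : (0 <= Lpnorm 1%:E a b x)%E by exact: Lnorm_ge0.
have n1 : (0 <= Lpnorm 1%:E a b (derive1 x))%E by exact: Lnorm_ge0.
have xr0 : (Lpnorm 1%:E a b x <= r%:E)%E.
  by apply: le_trans xr; rewrite /W11norm leeDl.
have xr1 : (Lpnorm 1%:E a b (derive1 x) <= r%:E)%E.
  by apply: le_trans xr; rewrite /W11norm leeDr.
have r0 : 0 <= r by rewrite -lee_fin; exact: le_trans xr0.
have ba : 0 < b - a by rewrite subr_gt0.
have incr s : a <= s <= b -> `|x t ord0 i| - r <= `|x s ord0 i|.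
  move=> /andP[as_ sb].
  suff : `|x t ord0 i - x s ord0 i| <= r.
    have := ler_normD (x t ord0 i - x s ord0 i) (x s ord0 i); rewrite subrK; lra.
  rewrite -lee_fin; apply: le_trans xr1.
  have [st|/ltW ts] := leP s t.
    apply: le_trans (Lpnorm1_le _ as_ tb).
    by apply: abs_continuous_increment => // j; exact: scalar_acS (acx j).
  rewrite distrC; apply: le_trans (Lpnorm1_le _ at_ sb).
  by apply: abs_continuous_increment => // j; exact: scalar_acS (acx j).
set c := `|x t ord0 i| - r in incr.
have [c0|c0] := leP c 0.
  have := mulr_ge0 (ltW (_ : 0 < (b - a)^-1)) r0; rewrite invr_gt0 => /(_ ba).
  rewrite mulrDl mul1r; rewrite /c in c0; lra.
suff : c <= (b - a)^-1 * r by rewrite /c mulrDl mul1r; lra.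
rewrite mulrC ler_pdivlMr// -lee_fin; apply: le_trans xr0.
have mab : measurable (`[a, b]%classic : set (measurableTypeR R)).
  exact: measurable_itv.
have -> : (c * (b - a))%:E = (\int[mu]_x ((cst c%:E) \_ `[a, b]) x)%E.
  have muab : mu `[a, b] = (b - a)%:E.
    by rewrite lebesgue_measure_itv/= lte_fin ab.
  rewrite -integral_mkcond integral_cst//. by rewrite EFinM -muab.
rewrite Lpnorm1E; apply: ge0_ae_le_integral.
- by move=> u; rewrite patchE; case: ifP => // _; rewrite lee_fin ltW.
- by move=> u; rewrite patchE; case: ifP => // _; rewrite lee_fin enorm_ge0.
apply: aeW => u; rewrite !patchE; case: ifPn => // uab.
rewrite lee_fin; apply: le_trans (enorm_ge_coord _ i); apply: incr.
by move: uab; rewrite inE/= in_itv.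
Qed.

Lemma lebesgue_setT_gt0 : (0 < mu setT)%E.
Proof.
apply: (@lt_le_trans _ _ (mu `[0, 1]%classic)).
  by rewrite lebesgue_measure_itv/= lte_fin ltr01 oppr0 adde0 lte_fin.
by apply: le_measure; rewrite ?inE//; exact: measurable_itv.
Qed.

Lemma Lpnorm_ooP k (a b : R) (v : R -> 'rV[R]_k) (y : \bar R) : (0 <= y)%E ->
  (Lpnorm +oo%E a b v <= y)%E <->
  ae_itv a b (fun t => ((enorm (v t))%:E <= y)%E).
Proof.
have aef := ae_filter_ringOfSetsType mu.
move=> y0; rewrite /Lpnorm unlock /= lebesgue_setT_gt0.
split.
  move/ess_supP; apply: filterS => t.
  rewrite /= patchE => H tab; move: H; rewrite mem_set//=.
  by rewrite ger0_norm// enorm_ge0.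
move=> H; apply/ess_supP; move: H; rewrite /ae_itv; apply: filterS => t H.
rewrite /= patchE; case: ifPn => [/set_mem/= /H|_]; last by rewrite abse0.
by rewrite /= ger0_norm// enorm_ge0.
Qed.

(** The interval contributes T eps, and the neighbourhood, of measure at most
    2 eps times the number of points, contributes D times its measure. *)
Lemma Lpnorm1_off_finite k (T D eps : R) (v : R -> 'rV[R]_k) (gs : seq R) :
  0 <= T -> 0 <= D -> 0 < eps ->
  ae_itv 0 T (fun t => enorm (v t) <= D) ->
  ae_itv 0 T (fun t => (forall s, s \in gs -> eps < `|t - s|) -> enorm (v t) <= eps) ->
  (Lpnorm 1%:E 0 T v <= ((T + 2 * D * (size gs)%:R) * eps)%:E)%E.
Proof.
have aef := ae_filter_ringOfSetsType mu.
move=> T0 D0 e0 vD veps.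
pose B := \big[setU/set0]_(s <- gs) `[s - eps, s + eps]%classic.
have mB : measurable B by apply: bigsetU_measurable => s _; exact: measurable_itv.
have muI s : (mu `[(s - eps)%R, (s + eps)%R]%classic <= (2 * eps)%:E)%E.
  rewrite lebesgue_measure_itv/= lte_fin; case: ifP => _; rewrite -?EFinB lee_fin; lra.
have muB : (mu B <= (2 * eps * (size gs)%:R)%:E)%E.
  rewrite /B; elim: gs {B mB veps} => [|s gs ih].
    by rewrite big_nil measure0 mulr0.
  rewrite big_cons; apply: le_trans (measureU2 _ _ _) _.
  - exact: measurable_itv.
  - by apply: bigsetU_measurable => s' _; exact: measurable_itv.
  rewrite [size _]/= -[(size gs).+1%:R]natr1 mulrDr mulr1 addrC EFinD leeD//; exact: muI.
have memB t : ~ B t -> forall s, s \in gs -> eps < `|t - s|.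
  move=> Bt s sgs; rewrite ltNge; apply/negP => ts; apply: Bt.
  rewrite /B -bigcup_seq; exists s => //=; rewrite in_itv/=.
  by move: ts; rewrite ler_norml; lra.
have mI : measurable (`[0, T]%classic : set R) by exact: measurable_itv.
pose f1 : R -> \bar R := (cst eps%:E) \_ `[0, T].
pose f2 : R -> \bar R := (cst D%:E) \_ B.
have f10 x : (0 <= f1 x)%E.
  by rewrite /f1 patchE; case: ifP => // _; rewrite lee_fin ltW.
have f20 x : (0 <= f2 x)%E by rewrite /f2 patchE; case: ifP.
apply: (@le_trans _ _ (\int[mu]_x (f1 x + f2 x))%E).
  rewrite Lpnorm1E; apply: ge0_ae_le_integral.
  - by move=> t; rewrite patchE; case: ifP => // _; rewrite lee_fin enorm_ge0.
  - by move=> t; rewrite adde_ge0.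
  move: vD veps; rewrite /ae_itv; apply: filterS2 => t tD te; rewrite patchE; case: ifPn => [tI|_]; last first.
    by rewrite adde_ge0.
  have tI' := set_mem tI.
  have [Bt|Bt] := pselect (B t).
    apply: (@le_trans _ _ (f2 t)); last by rewrite leeDr.
    by rewrite /f2 patchE mem_set// lee_fin tD.
  apply: (@le_trans _ _ (f1 t)); last by rewrite leeDl.
  by rewrite /f1 patchE tI lee_fin te//; exact: memB.
rewrite ge0_integralD//; last 2 first.
- by apply/(measurable_restrictT _ mI).
- by apply/(measurable_restrictT _ mB).
rewrite -!integral_mkcond !integral_cst//.
have muT : mu `[0, T] = T%:E.
  rewrite lebesgue_measure_itv/= lte_fin; case: ltP => T0'; first by rewrite oppr0 adde0.
  by congr _%:E; apply/eqP; rewrite eq_le T0.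
have -> : ((T + 2 * D * (size gs)%:R) * eps)%:E =
    (eps%:E * T%:E + D%:E * (2 * eps * (size gs)%:R)%:E)%E.
  by rewrite -!EFinM -EFinD; congr _%:E; ring.
rewrite -[in leRHS]muT leeD// lee_wpmul2l//; exact: muB.
Qed.

End sobolev.

Lemma ae_itvS (R : realType) (a b : R) (Q Q' : R -> Prop) :
  (forall t, t \in `[a, b] -> Q t -> Q' t) -> ae_itv a b Q -> ae_itv a b Q'.
Proof.
move=> QQ'; rewrite /ae_itv; have aef := ae_filter_ringOfSetsType (@lebesgue_measure R).
by apply: filterS => t Qt tI; apply: QQ' => //; exact: Qt.
Qed.

Lemma ae_itvI (R : realType) (a b : R) (Q Q' : R -> Prop) :
  ae_itv a b Q -> ae_itv a b Q' -> ae_itv a b (fun t => Q t /\ Q' t).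
Proof.
rewrite /ae_itv; have aef := ae_filter_ringOfSetsType (@lebesgue_measure R).
by apply: filterS2 => t Qt Qt' tI; split; [exact: Qt|exact: Qt'].
Qed.

(** * Polyhedra *)

(** This is used to move inside a polyhedron, or inside a cone of directions,
    until a further constraint becomes active. *)
Lemma first_hit (R : realFieldType) (I : finType) (A : {set I}) (al be : I -> R) :
  (forall i, i \in A -> al i <= 0) ->
  (forall i, i \in A -> al i = 0 -> be i <= 0) ->
  (exists2 i, i \in A & 0 < be i) ->
  exists t : R, [/\ 0 < t, forall i, i \in A -> al i + t * be i <= 0 &
    exists j, [/\ j \in A, 0 < be j & al j + t * be j = 0]].
Proof.
move=> al0 albe [i0 i0A bei0].
pose P i := (i \in A) && (0 < be i).
have P0 : P i0 by rewrite /P i0A.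
case: (arg_minP (fun i => - al i / be i) P0) => j /andP[jA bej] jmin.
have alj : al j < 0.
  rewrite lt_neqAle al0// andbT; apply/eqP => /albe => /(_ jA).
  by rewrite leNgt bej.
(* the earliest of the zeros of the increasing functions *)
exists (- al j / be j); split.
- by rewrite divr_gt0// oppr_gt0.
- move=> i iA; have [bei|bei] := leP (be i) 0.
    rewrite -[leRHS]addr0 lerD ?al0// mulr_ge0_le0//.
    by rewrite divr_ge0 ?(ltW bej)// oppr_ge0 ltW.
  have := jmin i; rewrite /P iA bei => /(_ isT).
  by rewrite ler_pdivlMr// => ?; lra.
- by exists j; split => //; rewrite divfK ?gt_eqF// subrr.
Qed.

Lemma small_move (R : realFieldType) (I : finType) (al be : I -> R) :
  (forall i, al i <= 0) -> (forall i, al i = 0 -> be i = 0) ->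
  exists2 t : R, 0 < t & forall i, al i + t * be i <= 0 /\ al i - t * be i <= 0.
Proof.
move=> al0 albe.
have [[i bei]|nobe] := pselect (exists i, be i != 0); last first.
  exists 1 => // i; have -> : be i = 0.
    by apply/eqP; apply: contrapT => /negP bei; apply: nobe; exists i.
  by rewrite mulr0 subr0 addr0.
have [|||t [t0 H _]] := @first_hit _ I [set: I] al (fun i => `|be i|).
- by move=> j _.
- by move=> j _ /albe ->; rewrite normr0.
- by exists i; rewrite ?inE// normr_gt0.
exists t => // j; have := H j (finset.in_setT _).
have := ler_norm (be j); have := ler_norm (- be j); rewrite normrN => h1 h2 h3.
have := ler_wpM2l (ltW t0) h1; have := ler_wpM2l (ltW t0) h2; rewrite mulrN.
by split; lra.
Qed.

Lemma finite_of_labels (T : choiceType) (I : finType) (A : set T) (x0 : T)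
    (lab : T -> I -> Prop) :
  (forall x, A x -> exists i, lab x i) ->
  (forall x y i, A x -> A y -> lab x i -> lab y i -> x = y) ->
  exists s : seq T, forall x, A x -> x \in s.
Proof.
move=> Al inj; exists [seq xget x0 [set x | A x /\ lab x i] | i <- enum I] => x Ax.
have [i xi] := Al x Ax; apply/mapP; exists i; first by rewrite mem_enum.
case: xgetP => [y _ [Ay yi]|/(_ x)]; first exact: inj yi.
by move=> /(_ (conj Ax xi)).
Qed.

Section polyhedron.
Context {R : realType} {m N : nat}.
Variables (av : 'I_N -> 'rV[R]_m) (bv : 'I_N -> R) (U : set 'rV[R]_m).
Hypothesis UE : U = [set v | forall i, dot (av i) v <= bv i].

Definition active (v : 'rV[R]_m) : {set 'I_N} :=
  [set i | dot (av i) v == bv i].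

(** The directions parallel to the face on which the constraints in J are
    active. *)
Definition flat (J : {set 'I_N}) (d : 'rV[R]_m) : Prop :=
  forall i, i \in J -> dot (av i) d = 0.

Definition vertex (v : 'rV[R]_m) : Prop :=
  U v /\ forall d, flat (active v) d -> d = 0.

Lemma polyP v : U v <-> forall i, dot (av i) v <= bv i.
Proof. by rewrite UE. Qed.

Lemma activeP v i : reflect (dot (av i) v = bv i) (i \in active v).
Proof. by rewrite inE; exact: eqP. Qed.

(** The constraints active at the midpoint of an edge leave only the line of the
    edge free, so they determine its direction up to sign. *)
Lemma edge_directions_finite :
  exists es : seq 'rV[R]_m, forall e, edge_directions U e -> e \in es.
Proof.
pose wit e (J : {set 'I_N}) := flat J e /\ forall d, flat J d -> exists c, d = c *: e.
have witE e : edge_directions U e -> exists J, wit e J.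
  move=> [e1 [a [b [ab [c FE] [kap bae]]]]].
  have mem s : 0 <= s <= 1 -> segment a b ((1 - s) *: a + s *: b).
    by move=> s01; exists s => //=; rewrite in_itv.
  have Fa : segment a b a.
    by have := mem 0; rewrite subr0 scale1r scale0r addr0 lexx ler01; apply.
  have Fb : segment a b b.
    by have := mem 1; rewrite subrr scale1r scale0r add0r lexx ler01; apply.
  have [mid midE] : exists mid, mid = (1 - 2^-1) *: a + 2^-1 *: b by eexists.
  have Fm : segment a b mid by rewrite midE; apply: mem; lra.
  have kap0 : kap != 0.
    by apply: contra_neq ab => k0; apply/esym/eqP; rewrite -subr_eq0 bae k0 scale0r.
  have [Ua _] : [set v | U v /\ forall w, U w -> dot c w <= dot c v] a by rewrite -FE.
  have [Ub _] : [set v | U v /\ forall w, U w -> dot c w <= dot c v] b by rewrite -FE.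
  have [Um midmax] : [set v | U v /\ forall w, U w -> dot c w <= dot c v] mid.
    by rewrite -FE.
  exists (active mid); split.
    move=> i /activeP; rewrite midE dotDr !dotZr => im.
    have := (polyP a).1 Ua i; have := (polyP b).1 Ub i => hb ha.
    have : dot (av i) (b - a) = 0 by rewrite dotBr; lra.
    by rewrite bae dotZr => /eqP; rewrite mulf_eq0 (negbTE kap0) => /eqP.
  move=> d fd.
  have [||t t0 H] := @small_move _ _ (fun i => dot (av i) mid - bv i) (fun i => dot (av i) d).
  - by move=> i; rewrite subr_le0; exact: (polyP mid).1.
  - by move=> i /eqP; rewrite subr_eq0 => /eqP im; apply: fd; exact/activeP.
  have U1 : U (mid + t *: d).
    by apply/polyP => i; have [] := H i; rewrite dotDr dotZr; lra.
  have U2 : U (mid - t *: d).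
    by apply/polyP => i; have [] := H i; rewrite dotBr dotZr; lra.
  have cd : t * dot c d = 0.
    by have := midmax _ U1; have := midmax _ U2; rewrite dotBr dotDr dotZr; lra.
  have : segment a b (mid + t *: d).
    by rewrite FE; split => // w /midmax; rewrite dotDr dotZr cd addr0.
  move=> [s _ sE].
  exists (t^-1 * ((s - 2^-1) * kap)); rewrite -!scalerA -bae.
  apply/rowP => j; have := congr1 (fun v : 'rV[R]_m => v ord0 j) sE.
  rewrite midE !mxE => sEj; apply: (mulfI (lt0r_neq0 t0)).
  by rewrite mulVKf ?(lt0r_neq0 t0)//; lra.
pose rf (J : {set 'I_N}) := xget 0 [set e | edge_directions U e /\ wit e J].
(* the Boolean tells the reference direction of J from its opposite *)
pose lab e (Jb : {set 'I_N} * bool) := wit e Jb.1 /\ Jb.2 = (e == rf Jb.1).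
apply: (@finite_of_labels _ _ _ 0 lab).
  by move=> e /witE[J eJ]; exists (J, e == rf J).
have pm e e' J : edge_directions U e -> edge_directions U e' -> wit e J ->
    wit e' J -> e' = e \/ e' = - e.
  move=> [e1 _] [e1' _] [_ eJ] [fe' _]; have [c ce] := eJ _ fe'.
  move: e1'; rewrite ce enormZ e1 mulr1 => /eqP; rewrite eqr_norml ler01 andbT.
  by case/orP => /eqP ->; [left; rewrite scale1r|right; rewrite scaleN1r].
move=> e e' [J b] Ee Ee' [/= eJ ->] [/= eJ'] /esym.
have [rfE [Er rJ]] : True /\ edge_directions U (rf J) /\ wit (rf J) J.
  split=> //; rewrite /rf; case: xgetP => [r _ //|/(_ e)].
  by move=> /(_ (conj Ee eJ)).
have [ee|en] := eqVneq e (rf J); have [ee'|en'] := eqVneq e' (rf J) => // _.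
  by rewrite ee ee'.
have [ee|->] := pm _ _ _ Er Ee rJ eJ; first by rewrite ee eqxx in en.
by have [ee'|->] := pm _ _ _ Er Ee' rJ eJ'; first by rewrite ee' eqxx in en'.
Qed.

Hypothesis Ubnd : exists M : R, forall v i, U v -> `|v ord0 i| <= M.

Lemma bounded_exit v d : U v -> d != 0 -> exists i, 0 < dot (av i) d.
Proof.
move=> Uv d0; apply: contrapT => nex.
have le0 i : dot (av i) d <= 0.
  by rewrite leNgt; apply/negP => di; apply: nex; exists i.
have [M HM] := Ubnd.
have [j dj] : exists j, d ord0 j != 0.
  apply/existsP; apply: contraNT d0; rewrite negb_exists => /forallP d0.
  by apply/eqP/rowP => i; rewrite mxE; have := d0 i; rewrite negbK => /eqP.
have dj0 : 0 < `|d ord0 j| by rewrite normr_gt0.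
have M0 : 0 <= M by apply: le_trans (HM v j Uv).
pose t := (M + M + 1) / `|d ord0 j|.
have t0 : 0 <= t by rewrite divr_ge0// !addr_ge0.
have Ut : U (v + t *: d).
  apply/polyP => i; rewrite dotDr dotZr; have := (polyP v).1 Uv i.
  have := mulr_ge0_le0 t0 (le0 i); lra.
have := HM _ j Ut; rewrite !mxE => h1; have h2 := HM _ j Uv.
have : `|t * d ord0 j| = M + M + 1.
  by rewrite normrM (ger0_norm t0) divfK ?gt_eqF.
have := ler_normB (v ord0 j + t * d ord0 j) (v ord0 j).
by rewrite addrAC subrr add0r; lra.
Qed.

(** Among the points not worse than u for s, one with as many active constraints
    as possible is a vertex: otherwise it could be moved downhill, keeping its
    active constraints, until a further constraint becomes active. *)
Lemma move_to_vertex s u : U u -> exists2 v, vertex v & dot s v <= dot s u.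
Proof.
move=> Uu.
pose P J := `[< exists v, [/\ U v, dot s v <= dot s u & active v = J] >].
have P0 : P (active u) by apply/asboolP; exists u.
case: (arg_maxP (fun J : {set 'I_N} => #|J|) P0) => J /asboolP[v [Uv vu vJ]] Jmax.
exists v => //; split => // d0 fd0; apply: contrapT => /eqP d0N.
have [d [fd dN sd]] : exists d, [/\ flat (active v) d, d != 0 & dot s d <= 0].
  have [sd|/ltW sd] := leP (dot s d0) 0; first by exists d0.
  exists (- d0); rewrite oppr_eq0 dotNr oppr_le0; split => // i iv.
  by rewrite dotNr fd0// oppr0.
have [|||t [t0 H [j [_ bej hj]]]] := @first_hit _ _ [set: 'I_N]
    (fun i => dot (av i) v - bv i) (fun i => dot (av i) d).
- by move=> i _; rewrite subr_le0; exact: (polyP v).1.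
- by move=> i _ /eqP; rewrite subr_eq0 => /eqP iv; rewrite fd//; exact/activeP.
- by have [i] := bounded_exit Uv dN; exists i; rewrite ?inE.
have jv : j \notin active v.
  by apply/negP => /fd dj; move: bej; rewrite dj ltxx.
have sub : active v \proper active (v + t *: d).
  apply/fintype.properP; split; last first.
    exists j => //; apply/activeP; rewrite dotDr dotZr; lra.
  apply/fintype.subsetP => i /[dup] iv /activeP ib; apply/activeP.
  by rewrite dotDr dotZr fd// mulr0 addr0.
have PJ : P (active (v + t *: d)).
  apply/asboolP; exists (v + t *: d); split => //.
    by apply/polyP => i; rewrite dotDr dotZr; have := H i (finset.in_setT _); lra.
  by rewrite dotDr dotZr; have := mulr_ge0_le0 (ltW t0) sd; lra.
by have : (#|active (v + t *: d)| <= #|J|)%N := Jmax _ PJ; rewrite -vJ leqNgt proper_card.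
Qed.

(** A vertex is determined by its active set, so this is the vertex with active
    set J, if there is one; in particular there are finitely many vertices. *)
Definition vertex_of (J : {set 'I_N}) : 'rV[R]_m :=
  xget 0 [set v | vertex v /\ active v = J].

Lemma vertex_ofE v : vertex v -> vertex_of (active v) = v.
Proof.
move=> Vv; rewrite /vertex_of; case: xgetP => [w _ [Vw wv]|/(_ v)]; last first.
  by move=> /(_ (conj Vv erefl)).
apply/eqP; rewrite -subr_eq0; apply/eqP; have [_] := Vv; apply => i iv.
rewrite dotBr; have /activeP -> := iv; move: iv; rewrite -wv => /activeP ->.
by rewrite subrr.
Qed.

Lemma vertex_argmin s u : U u ->
  exists2 v, vertex v & forall w, U w -> dot s v <= dot s w.
Proof.
move=> /(move_to_vertex s)[v0 Vv0 _].
pose P J := `[< vertex (vertex_of J) >].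
have P0 : P (active v0) by apply/asboolP; rewrite vertex_ofE.
case: (arg_minP (fun J => dot s (vertex_of J)) P0) => J /asboolP VJ Jmin.
exists (vertex_of J) => // w /(move_to_vertex s)[v Vv]; apply: le_trans.
have := Jmin (active v); rewrite vertex_ofE//; apply.
by apply/asboolP; rewrite vertex_ofE.
Qed.

(** The sum of the constraints tight along d exposes the segment from v to the
    point where the ray in direction d leaves the polyhedron. *)
Lemma edge_at_vertex v d : vertex v -> d != 0 ->
  (forall i, i \in active v -> dot (av i) d <= 0) ->
  (forall d', (forall i, i \in active v -> dot (av i) d = 0 -> dot (av i) d' = 0) ->
    exists c, d' = c *: d) ->
  edge_directions U ((enorm d)^-1 *: d) /\
    exists2 tau, 0 < tau & U (v + tau *: d).
Proof.
move=> [Uv Vv] dN Cd line.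
have ed := enorm_gt0 dN.
have [|||tau [tau0 H [j [_ bej hj]]]] := @first_hit _ _ [set: 'I_N]
    (fun i => dot (av i) v - bv i) (fun i => dot (av i) d).
- by move=> i _; rewrite subr_le0; exact: (polyP v).1.
- by move=> i _ /eqP; rewrite subr_eq0 => /eqP iv; apply: Cd; exact/activeP.
- by have [i] := bounded_exit Uv dN; exists i; rewrite ?inE.
have Ud t : 0 <= t <= tau -> U (v + t *: d).
  move=> /andP[t0 tt]; apply/polyP => i; rewrite dotDr dotZr.
  have Uvi := (polyP v).1 Uv i; have := H i (finset.in_setT _).
  have [di|/ltW di] := leP (dot (av i) d) 0; first by have := mulr_ge0_le0 t0 di; lra.
  by have := ler_wpM2r di tt; lra.
split; last by exists tau => //; apply: Ud; rewrite (ltW tau0) lexx.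
split.
  by rewrite enormZ ger0_norm ?invr_ge0 ?(ltW ed)// mulVf ?gt_eqF.
exists v, (v + tau *: d); split.
- by rewrite eq_sym -subr_eq0 addrAC subrr add0r scaler_eq0 negb_or gt_eqF.
- pose J := [set i in active v | dot (av i) d == 0].
  pose c := \sum_(i in J) av i.
  have Jact i : i \in J -> dot (av i) v = bv i.
    by rewrite inE => /andP[/activeP].
  have cle w : U w -> dot c w <= dot c v.
    move=> /polyP Uw; rewrite !dot_suml; apply: ler_sum => i iJ.
    by rewrite Jact.
  exists c; apply/seteqP; split => [w [s /=]|w [Uw wmax]].
    rewrite in_itv/= => /andP[s0 s1] <-.
    have -> : (1 - s) *: v + s *: (v + tau *: d) = v + (s * tau) *: d.
      by rewrite scalerDr addrA -scalerDl subrK scale1r scalerA.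
    split.
      by apply: Ud; rewrite mulr_ge0// ?(ltW tau0)// ger_pMl.
    move=> w' /cle; rewrite dotDr dotZr [dot c d](_ : _ = 0) ?mulr0 ?addr0//.
    by rewrite dot_suml big1// => i; rewrite inE => /andP[_ /eqP].
  have Jw i : i \in J -> dot (av i) w = bv i.
    move=> iJ; apply/eqP; rewrite eq_le (polyP w).1//= leNgt; apply/negP => wi.
    have := wmax v Uv; rewrite leNgt => /negP; apply.
    rewrite !dot_suml (bigD1 i)//= [X in _ < X](bigD1 i)//= ltr_leD// ?Jact//.
    apply: ler_sum => i' /andP[iJ' _]; rewrite Jact//; exact: (polyP w).1.
  have [t wt] : exists t, w - v = t *: d.
    apply: line => i iv di; have iJ : i \in J by rewrite inE iv di eqxx.
    by rewrite dotBr Jw// Jact// subrr.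
  have {wt} wE : w = v + t *: d by rewrite -wt addrC subrK.
  have t0 : 0 <= t.
    rewrite leNgt; apply/negP => t0.
    have [i iv di] : exists2 i, i \in active v & dot (av i) d < 0.
      apply: contrapT => nex; move: dN; rewrite (Vv d) ?eqxx// => i iv.
      apply/eqP; rewrite eq_le Cd//= leNgt; apply/negP => di; apply: nex.
      by exists i.
    have := (polyP w).1 Uw i; rewrite wE dotDr dotZr; have /activeP -> := iv.
    have := nmulr_rgt0 (dot (av i) d) t0; rewrite di; lra.
  have tt : t <= tau.
    rewrite leNgt; apply/negP => tt.
    have := (polyP w).1 Uw j; rewrite wE dotDr dotZr.
    have := ltr_pM2r bej tau t; rewrite tt; lra.
  exists (t / tau).
    by rewrite /= in_itv/= divr_ge0 ?(ltW tau0)//= ler_pdivrMr// mul1r.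
  rewrite scalerDr addrA -scalerDl subrK scale1r scalerA divfK ?gt_eqF//.
- exists (tau * enorm d); rewrite addrAC subrr add0r scalerA -mulrA divff ?mulr1//.
  by rewrite gt_eqF.
Qed.

(** The step of the simplex method.  The directions from the vertex form a
    pointed cone, and a downhill direction with as many tight constraints as
    possible spans an extreme ray of it. *)
Lemma downhill_edge v s' w : vertex v -> U w -> w != v -> dot s' (w - v) <= 0 ->
  exists e tau, [/\ edge_directions U e, 0 < tau, U (v + tau *: e) & dot s' e <= 0].
Proof.
move=> Vv Uw wv sw; have [Uv Vv2] := Vv.
pose C d := forall i, i \in active v -> dot (av i) d <= 0.
pose tight d := [set i in active v | dot (av i) d == 0].
have tightE d i : (i \in tight d) = (i \in active v) && (dot (av i) d == 0).
  by rewrite inE.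
pose P J := `[< exists d, [/\ C d, d != 0, dot s' d <= 0 & tight d = J] >].
have P0 : P (tight (w - v)).
  apply/asboolP; exists (w - v); split => //; last by rewrite subr_eq0.
  move=> i /activeP iv; rewrite dotBr iv subr_le0; exact: (polyP w).1.
case: (arg_maxP (fun J : {set 'I_N} => #|J|) P0) => J /asboolP[d [Cd dN sd dJ]] Jmax.
(* h is positive on the nonzero directions of the cone *)
pose h := - \sum_(i in active v) av i.
have h0 g : C g -> g != 0 -> 0 < dot h g.
  move=> Cg gN; rewrite /h dotNl dot_suml -sumrN lt_neqAle eq_sym.
  have ge0 i : i \in active v -> 0 <= - dot (av i) g by move=> /Cg; rewrite oppr_ge0.
  rewrite sumr_ge0// andbT; apply: contra gN; rewrite psumr_eq0// => /allP sg.
  apply/eqP/Vv2 => i iv; have := sg i (mem_index_enum _).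
  by rewrite iv/= oppr_eq0 => /eqP.
have hd : 0 < dot h d by exact: h0.
have line d' : (forall i, i \in active v -> dot (av i) d = 0 -> dot (av i) d' = 0) ->
    exists c, d' = c *: d.
  move=> fd'.
  (* subtracting a multiple of d brings d' into the kernel of h, so that
     neither the result nor its opposite is a nonzero element of the cone *)
  pose g0 := d' - (dot h d' / dot h d) *: d.
  have [g00|g0N] := eqVneq g0 0.
    by exists (dot h d' / dot h d); apply/eqP; rewrite -subr_eq0; apply/eqP.
  have hg0 : dot h g0 = 0 by rewrite dotBr dotZr divfK ?gt_eqF// subrr.
  have fg0 i : i \in active v -> dot (av i) d = 0 -> dot (av i) g0 = 0.
    by move=> iv di; rewrite dotBr dotZr di mulr0 subr0 fd'.
  have [g [gN hg fg sg]] : exists g, [/\ g != 0, dot h g = 0,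
      forall i, i \in active v -> dot (av i) d = 0 -> dot (av i) g = 0 &
      dot s' g <= 0].
    have [sg|/ltW sg] := leP (dot s' g0) 0; first by exists g0.
    exists (- g0); rewrite oppr_eq0 !dotNr hg0 oppr0 oppr_le0; split => // i iv di.
    by rewrite dotNr fg0// oppr0.
  exfalso.
  have [|||t [t0 H [j [jv bej hj]]]] := @first_hit _ _ (active v)
    (fun i => dot (av i) d) (fun i => dot (av i) g).
  - exact: Cd.
  - by move=> i iv di; rewrite fg.
  - apply: contrapT => nex; have := h0 g; rewrite hg ltxx => hg'.
    apply: notF; apply: hg' => // i iv; rewrite leNgt; apply/negP => gi.
    by apply: nex; exists i.
  have PJ : P (tight (d + t *: g)).
    apply/asboolP; exists (d + t *: g); split => //.
    + by move=> i iv; rewrite dotDr dotZr; exact: H.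
    + apply/eqP => dg; have : dot h (d + t *: g) = dot h d by rewrite dotDr dotZr hg mulr0 addr0.
      by rewrite dg dot0r => hd0; move: hd; rewrite -hd0 ltxx.
    + by rewrite dotDr dotZr; have := mulr_ge0_le0 (ltW t0) sg; lra.
  have pr : tight d \proper tight (d + t *: g).
    apply/fintype.properP; split; last first.
      exists j; first by rewrite inE jv dotDr dotZr hj eqxx.
      rewrite inE jv/=; apply/eqP => dj; have := fg j jv dj.
      by move=> gj; move: bej; rewrite gj ltxx.
    apply/fintype.subsetP => i; rewrite !tightE => /andP[iv /eqP di].
    by rewrite iv dotDr dotZr di fg// mulr0 addr0 eqxx.
  by have : (#|tight (d + t *: g)%R| <= #|J|)%N := Jmax _ PJ; rewrite -dJ leqNgt proper_card.
have [Ed [tau tau0 Utau]] := edge_at_vertex Vv dN Cd line.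
have ed := enorm_gt0 dN.
exists ((enorm d)^-1 *: d), (tau * enorm d); split => //.
- exact: mulr_gt0.
- by rewrite scalerA -mulrA divff ?mulr1// gt_eqF.
- by rewrite dotZr mulr_ge0_le0// invr_ge0 ltW.
Qed.

(** From a vertex that minimizes s some edge leads downhill for s' when the
    minimizer of s' is another point.  Otherwise the vertex is u' and differs
    from u, and an edge that is downhill for s is orthogonal to s.  The sign
    condition says that a functional between s and s' is orthogonal to e. *)
Lemma argmin_change s s' u u' : U u -> U u' -> u != u' ->
  (forall v, vertex v -> dot s u <= dot s v) ->
  (forall v, vertex v -> dot s' u' <= dot s' v) ->
  exists2 e, edge_directions U e & dot s e * dot s' e <= 0.
Proof.
move=> Uu Uu' uu' su su'; have [v Vv vmin] := vertex_argmin s Uu.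
have [vu'|vu'] := eqVneq u' v.
  have [e [tau [Ee t0 Ut se]]] : exists e tau, [/\ edge_directions U e, 0 < tau,
      U (v + tau *: e) & dot s e <= 0].
    apply: (@downhill_edge v s u) => //; first by rewrite -vu'.
    by rewrite dotBr subr_le0 su.
  exists e => //; have := vmin _ Ut; rewrite dotDr dotZr lerDl pmulr_rge0// => se'.
  have -> : dot s e = 0 by apply/eqP; rewrite eq_le se.
  by rewrite mul0r.
have [e [tau [Ee t0 Ut se]]] : exists e tau, [/\ edge_directions U e, 0 < tau,
    U (v + tau *: e) & dot s' e <= 0].
  by apply: (@downhill_edge v s' u') => //; rewrite dotBr subr_le0 su'.
exists e => //; have := vmin _ Ut; rewrite dotDr dotZr lerDl pmulr_rge0// => se'.
exact: mulr_ge0_le0.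
Qed.

End polyhedron.

(** * Linear growth of the switching function off its zeros *)

Section growth.
Context {R : realType}.
Variables (T eta0 mu0 : R) (phi : R -> R).
Hypotheses (T0 : 0 <= T) (eta0_gt0 : 0 < eta0) (mu0_gt0 : 0 < mu0).
Hypothesis growth : forall s, s \in `[0, T] -> phi s = 0 ->
  forall t, t \in `[s - eta0, s + eta0] -> t \in `[0, T] ->
  mu0 * `|t - s| <= `|phi t|.

Lemma zeros_separated s s' : s \in `[0, T] -> s' \in `[0, T] ->
  phi s = 0 -> phi s' = 0 -> `|s' - s| <= eta0 -> s = s'.
Proof.
move=> sT s'T ps ps' ss'.
have := growth sT ps (t := s'); rewrite ps' normr0 => /(_ _ s'T) H.
have : mu0 * `|s' - s| <= 0.
  apply: H; move: ss'; rewrite in_itv/= ler_norml; lra.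
rewrite pmulr_rle0// normr_le0 subr_eq0 => /eqP ->//.
Qed.

(** Zeros are separated by eta0, so the cell of length eta0 that contains a zero
    identifies it. *)
Lemma zeros_finite : exists gs : seq R,
  forall s, s \in `[0, T] -> phi s = 0 -> s \in gs.
Proof.
pose K := (Num.truncn (T / eta0)).+1.
have [||gs H] := @finite_of_labels _ 'I_K
    [set s | s \in `[0, T] /\ phi s = 0] 0 (fun s i => Num.truncn (s / eta0) = i).
- move=> s [sT _]; have : (Num.truncn (s / eta0) < K)%N.
    rewrite /K ltnS le_truncn// ler_pM2r ?invr_gt0//.
    by move: sT; rewrite in_itv/= => /andP[].
  by move=> sK; exists (Ordinal sK).
- move=> s s' i [sT ps] [s'T ps'] si s'i; apply: zeros_separated => //.
  have tr x : x \in `[0, T] -> Num.truncn (x / eta0) = i ->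
      eta0 * i%:R <= x < eta0 * i.+1%:R.
    rewrite in_itv/= => /andP[x0 _] xi.
    have := @truncn_itv _ (x / eta0); rewrite divr_ge0 ?(ltW eta0_gt0)// => /(_ isT).
    by rewrite xi ler_pdivlMr// ltr_pdivrMr// !(mulrC eta0).
  have := tr _ sT si; have := tr _ s'T s'i.
  rewrite -addn1 natrD mulrDr mulr1 => /andP[? ?] /andP[? ?].
  by rewrite ler_norml; apply/andP; split; lra.
by exists gs => s sT ps; apply: H.
Qed.

(** Within eta0 of a zero the growth condition applies; the other points form a
    compact set, on which the function has a positive minimum. *)
Lemma growth_off_zeros : scalar_ac 0 T phi ->
  exists2 c : R, 0 < c & forall eps t, t \in `[0, T] ->
    (forall s, s \in `[0, T] -> phi s = 0 -> eps < `|t - s|) ->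
    Num.min (mu0 * eps) c <= `|phi t|.
Proof.
move=> acphi; have ac := scalar_ac_unif_continuous acphi.
pose f t := `|phi (clamp 0 T t)|.
have cf : continuous f.
  move=> x; apply/(@cvgrPdist_lt _ R^o) => /= e e0.
  have [d d0 H] := ac e e0; near=> y.
  rewrite /f; apply: le_lt_trans (ler_dist_dist _ _) _.
  have xy : `|x - y| < d by near: y; exact: cvgr_dist_lt.
  have /andP[x1 x2] := clamp_itv x T0; have /andP[y1 y2] := clamp_itv y T0.
  have [le|/ltW le] := leP x y.
    rewrite distrC; apply: H => //; first exact: clamp_le.
    apply: le_lt_trans (clamp_shorten _ _ le) _.
    by move: xy; rewrite ltr_norml; lra.
  apply: H => //; first exact: clamp_le.
  apply: le_lt_trans (clamp_shorten _ _ le) _.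
  by move: xy; rewrite ltr_norml; lra.
pose Z := [set s | s \in `[0, T] /\ phi s = 0].
pose K := `[0, T]%classic `&` \bigcap_(s in Z) [set t | eta0 <= `|t - s|].
have Kc : compact K.
  apply: (@subclosed_compact _ _ `[0, T]%classic).
  - apply: closedI; first exact: interval_closed.
    apply: closed_bigI => s _.
    apply: (@closed_comp _ _ (fun t => `|t - s|) [set y | eta0 <= y]).
      by move=> t _; apply: (@cvg_norm _ R^o); apply: cvgB; [exact: cvg_id|exact: cvg_cst].
    exact: closed_ge.
  - exact: segment_compact.
  - by move=> t [].
have fE t : t \in `[0, T] -> f t = `|phi t|.
  by rewrite in_itv/= => tT; rewrite /f clamp_id.
have near_zero t s eps : t \in `[0, T] -> Z s -> `|t - s| < eta0 ->
    eps < `|t - s| -> mu0 * eps <= `|phi t|.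
  move=> tT [sT ps] ts es.
  have tin : t \in `[s - eta0, s + eta0].
    by move: ts; rewrite in_itv/= ltr_norml; lra.
  apply: le_trans (growth sT ps tin tT); rewrite ler_pM2l//; exact: ltW.
have [c c0 cK] : exists2 c, 0 < c & forall t, K t -> c <= f t.
  have [K0|/set0P K0] := eqVneq K set0.
    by exists 1 => // t; rewrite K0.
  have [t0 t0K tmin] := compact_EVT_min K0 Kc (continuous_subspaceT cf).
  exists (f t0); last by move=> t Kt; apply: tmin; rewrite inE.
  move/set_mem: t0K => [t0T t0Z].
  rewrite fE// normr_gt0; apply/eqP => pt0.
  by have := t0Z t0 (conj t0T pt0); rewrite /= subrr normr0 leNgt eta0_gt0.
exists c => // eps t tT tZ; rewrite ge_min.
have [[s [sZ ts]]|nex] := pselect (exists s, Z s /\ `|t - s| < eta0).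
  by rewrite (near_zero t s)// tZ//; case: sZ.
apply/orP; right; rewrite -fE//; apply: cK; split => // s sZ /=.
by rewrite leNgt; apply/negP => ts; apply: nex; exists s.
Unshelve. all: by end_near. Qed.

End growth.

Lemma uniform_positive (R : realType) (T : eqType) (es : seq T) (E : set T)
    (Q : T -> R -> Prop) :
  (forall e, E e -> exists2 c, 0 < c & Q e c) ->
  (forall e c c', c' <= c -> Q e c -> Q e c') ->
  exists2 c, 0 < c & forall e, E e -> e \in es -> Q e c.
Proof.
move=> EQ Qle; elim: es => [|e es [c c0 ih]]; first by exists 1.
have [Ee|nEe] := pselect (E e); last first.
  by exists c => // e' Ee'; rewrite inE => /orP[/eqP ee'|]; [case: nEe; rewrite -ee'|exact: ih].
have [c' c'0 Qc'] := EQ e Ee; exists (Num.min c c'); first by rewrite lt_min c0.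
move=> e' Ee'; rewrite inE => /orP[/eqP ->|e'es].
  by apply: Qle Qc'; rewrite ge_min lexx orbT.
by apply: Qle (ih _ Ee' e'es); rewrite ge_min lexx.
Qed.

(** * The gradient of the Hamiltonian in affine problems *)

Lemma bounded_ray_slope0 (R : realType) (x y C : R) :
  (forall k : nat, `|x + k%:R * y| <= C) -> y = 0.
Proof.
move=> H; apply/eqP; apply: contrapT => /negP y0.
have y0' : 0 < `|y| by rewrite normr_gt0.
have C0 : 0 <= C by apply: le_trans (H 0%N).
pose k := (Num.truncn ((C + `|x|) / `|y|)).+1.
have := H k; have : C + `|x| < k%:R * `|y|.
  by rewrite -ltr_pdivrMr// truncnS_gt.
have := ler_normB (x + k%:R * y) x; rewrite addrAC subrr add0r normrM normr_nat.
lra.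
Qed.

(** If the slopes at two points differed, then the values there would drift apart
    linearly along a ray in u, while the distance of the arguments is constant. *)
Lemma lipschitz_affine_slope (R : realType) (Q V W : normedModType R) (L : R)
    (F : Q -> V -> W -> R) (p p' : Q) (x x' : V) (c c' : R) (l l' : W -> R) :
  (forall u v, `|F p x u - F p' x' v| <= L * `|(p, (x, u)) - (p', (x', v))|) ->
  (forall u, F p x u = c + l u) -> (forall u, F p' x' u = c' + l' u) ->
  (forall k u, l (k *: u) = k * l u) -> (forall k u, l' (k *: u) = k * l' u) ->
  l =1 l'.
Proof.
move=> lip FE FE' lZ lZ' u; apply/eqP; rewrite -subr_eq0; apply/eqP.
apply: (@bounded_ray_slope0 _ (c - c') _ (L * `|(p, (x, 0 : W)) - (p', (x', 0))|)) => k.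
have := lip (k%:R *: u) (k%:R *: u); rewrite FE FE' lZ lZ'.
have -> : (p, (x, k%:R *: u)) - (p', (x', k%:R *: u)) = (p, (x, 0)) - (p', (x', 0)).
  by congr (_, (_, _)); rewrite /= !subrr.
by apply: le_trans; rewrite le_eqVlt; apply/orP; left; apply/eqP; congr `|_|; ring.
Qed.

Section affine.
Context {R : realType} {l n m : nat} (P : problem R l n m) (L : R).
Hypothesis aff : affine_in_control P.

Lemma run_slope :
  twice_diff_lipschitz L
    (fun (p : 'rV[R]_l) (w : 'rV[R]_n * 'rV[R]_m) => run P p w.1 w.2 : R^o) ->
  exists b : 'rV[R]_m, forall p x, exists c, forall u,
    run P p x u = c + dot b u.
Proof.
move=> [_ _ lip _ _]; have [_ [c0 [b0 b0E]]] := aff 0 0.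
exists b0 => p x; have [_ [c [b bE]]] := aff p x; exists c => u.
rewrite bE; congr (_ + _).
apply: (@lipschitz_affine_slope R 'rV[R]_l 'rV[R]_n 'rV[R]_m L (run P) p 0 x 0 c c0
  (dot b) (dot b0)) => //; try by move=> k v; rewrite dotZr.
by move=> u1 u2; exact: (lip ((p, (x, u1)), (0, (0, u2)))).
Qed.

Lemma dyn_slope :
  twice_diff_lipschitz L
    (fun (p : 'rV[R]_l) (w : 'rV[R]_n * 'rV[R]_m) => dyn P p w.1 w.2) ->
  exists B : 'M[R]_(m, n), forall p x, exists a, forall u,
    dyn P p x u = a + u *m B.
Proof.
move=> [_ _ lip _ _]; have [[a0 [B0 B0E]] _] := aff 0 0.
exists B0 => p x; have [[a [B BE]] _] := aff p x; exists a => u.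
rewrite BE; congr (_ + _); apply/rowP => j.
apply: (@lipschitz_affine_slope R 'rV[R]_l 'rV[R]_n 'rV[R]_m L
  (fun p x u => dyn P p x u ord0 j) p 0 x 0 (a ord0 j) (a0 ord0 j)
  (fun u => (u *m B) ord0 j) (fun u => (u *m B0) ord0 j)).
- move=> u1 u2; apply: le_trans (lip ((p, (x, u1)), (0, (0, u2))) _) => //=.
  by have := norm_coord_le (dyn P p x u1 - dyn P 0 0 u2) j; rewrite !mxE.
- by move=> v; rewrite BE mxE.
- by move=> v; rewrite B0E mxE.
- by move=> k v; rewrite -scalemxAl mxE.
- by move=> k v; rewrite -scalemxAl mxE.
Qed.

Lemma grad_affine k (F : 'rV[R]_k -> R) c g :
  (forall u, F u = c + dot g u) -> forall u, grad F u = g.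
Proof.
move=> FE u; apply/rowP => i; rewrite mxE.
apply: cvg_lim => //; apply: cvg_near_cst; near=> h.
have h0 : h != 0 by near: h; exact: nbhs_dnbhs_neq.
rewrite /= !FE [h *: _ + u]addrC dotDr dotZr.
rewrite [X in _ *: X](_ : _ = h * dot g (delta_mx ord0 i)); last by ring.
rewrite /GRing.scale /= mulKf// /dot (bigD1 i)//= !mxE !eqxx mulr1 big1 ?addr0//.
by move=> j ji; rewrite mxE (negbTE ji) mulr0.
Unshelve. all: by end_near. Qed.

(** As a consequence the switching function inherits the continuity of the
    adjoint function, however irregular the parameter function is. *)
Lemma grad_u_H_affine :
  assumption_A1 P L ->
  exists (b : 'rV[R]_m) (B : 'M[R]_(n, m)), forall p x lam u,
    grad_u_H P p x lam u = b + lam *m B.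
Proof.
move=> [_ _ /dyn_slope[B BE] /run_slope[b bE] _].
exists b, B^T => p x lam u; rewrite /grad_u_H.
have [a aE] := BE p x; have [c cE] := bE p x.
apply: (@grad_affine _ _ (c + dot lam a)) => u'.
by rewrite /hamiltonian aE cE dotDr dot_mulmx dotDl; ring.
Qed.

End affine.

(** * The variational inequality, pointwise *)

Lemma measurable_dot (R : realType) k (D : set R) (v w : R -> 'rV[R]_k) :
  (forall i, measurable_fun D (fun t => v t ord0 i)) ->
  (forall i, measurable_fun D (fun t => w t ord0 i)) ->
  measurable_fun D (fun t => dot (v t) (w t)).
Proof.
move=> mv mw; apply: measurable_sum => i; exact: measurable_funM.
Qed.

(** The variational inequality is tested with the control that equals v0 exactly
    where v0 violates the pointwise inequality. *)
Lemma normal_cone_ae (R : realType) l n m (P : problem R l n m) (tau : R) u w v0 :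
  controls P tau u -> normal_cone P tau u w -> ctrlset P v0 ->
  ae_itv tau (horizon P) (fun t => dot (w t) (v0 - u t) <= 0).
Proof.
pose mu := @lebesgue_measure R; have aef := ae_filter_ringOfSetsType mu.
move=> [[mu_ un] Uu] [[mw wn] Hw] Uv0.
set I := `[tau, horizon P]%classic.
have mI : measurable I by exact: measurable_itv.
pose g t := dot (w t) (v0 - u t).
have mg : measurable_fun I g.
  apply: measurable_dot => // i.
  under eq_fun do rewrite !mxE.
  by apply: measurable_funB.
have mb : measurable_fun I (fun t => 0 < g t).
  exact: measurable_fun_ltr.
pose v t := if 0 < g t then v0 else u t.
have cv : controls P tau v.
  split; first split.
  - move=> i; rewrite (_ : (fun t => _) = (fun t => if 0 < g t then v0 ord0 i else u t ord0 i)).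
      apply: measurable_fun_if => //; apply: measurable_funS (mu_ i) => //.
    by apply/funext => t; rewrite /v; case: ifP.
  - set y := maxe (enorm v0)%:E (Lpnorm +oo%E tau (horizon P) u).
    have y0 : (0 <= y)%E by rewrite le_max lee_fin enorm_ge0.
    apply: (@le_lt_trans _ _ y); last by rewrite gt_max ltry.
    apply/Lpnorm_ooP => //.
    have := (Lpnorm_ooP tau (horizon P) u (Lnorm_ge0 _ _ _)).1 (lexx _).
    rewrite /ae_itv; apply: filterS => t Ht tI; rewrite /v le_max; case: ifP => _; first by rewrite lexx.
    by rewrite Ht// orbT.
  - by move: Uu; rewrite /ae_itv; apply: filterS => t Ht tI; rewrite /v; case: ifP => // _; exact: Ht.
have := Hw v cv.
pose h t := if 0 < g t then g t else 0.
have hE t : dot (w t) (v t - u t) = h t.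
  by rewrite /v /h; case: ifP => // _; rewrite subrr dot0r.
under eq_integral do rewrite hE.
have h0 t : 0 <= h t by rewrite /h; case: ifP => // /ltW.
have mh : measurable_fun I (EFin \o h).
  apply/measurable_EFinP; apply: measurable_fun_if => //.
  by apply: measurable_funS mg.
move=> int0.
have : (\int[mu]_(t in I) `|(h t)%:E| = 0)%E.
  apply/eqP; rewrite eq_le integral_ge0 ?andbT; last by move=> t _; exact: abse_ge0.
  apply: le_trans int0; rewrite le_eqVlt; apply/orP; left; apply/eqP.
  by apply: eq_integral => t _; rewrite gee0_abs// lee_fin.
move/(ae_eq_integral_abs mu mI mh).1; rewrite /ae_itv; apply: filterS => t Ht tI.
have : h t = 0 by have := Ht tI => -[].
by rewrite /h -/(g t); case: ltP => // g0 g00; move: g0; rewrite g00 ltxx.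
Qed.

(** * Sub-regularity in the two metrics *)

Lemma norm_le_dist_opposite (R : realDomainType) (x y : R) : x * y <= 0 ->
  `|x| <= `|x - y|.
Proof.
move=> xy; rewrite -ler_sqr ?nnegrE// !real_normK ?num_real// sqrrB.
rewrite -addrA lerDl addr_ge0 ?sqr_ge0// oppr_ge0 mulrn_wle0//.
Qed.

Section regularity.
Context {R : realType} {l n m : nat}.
Variables (P : problem R l n m) (phat : R -> 'rV[R]_l) (yhat : Ypoint R n m).
Local Notation T := (horizon P).
Local Notation U := (ctrlset P).
Local Notation sigmahat := (switching P phat yhat).
Local Notation Gamma := (switching_points T U sigmahat).
Local Notation mu := (@lebesgue_measure R).

Variables (b : 'rV[R]_m) (B : 'M[R]_(n, m)).
Hypothesis gradE : forall p x lam u, grad_u_H P p x lam u = b + lam *m B.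
Variables (es : seq 'rV[R]_m).
Hypothesis esP : forall e, edge_directions U e -> e \in es.
Hypothesis T0 : 0 < T.
Hypothesis Yhat : Yspace P 0 yhat.
Variables (eta0 mu0 : R).
Hypotheses (eta0_gt0 : 0 < eta0) (mu0_gt0 : 0 < mu0).
Hypothesis growth : forall e s, edge_directions U e -> s \in `[0, T] ->
  dot (sigmahat s) e = 0 ->
  forall t, t \in `[s - eta0, s + eta0] -> t \in `[0, T] ->
    mu0 * `|t - s| <= `|dot (sigmahat t) e|.

Lemma switching_ac e : scalar_ac 0 T (fun t => dot (sigmahat t) e).
Proof.
have [_ acl _] := Yhat.
(* the summand 1 makes the constant positive *)
pose C := \sum_i `|(e *m B^T) ord0 i| + 1.
apply: (abs_continuous_scalar (C := C) _ _ acl).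
  by rewrite ltr_pwDr// sumr_ge0.
move=> s t; rewrite /switching !gradE -dotBl opprD addrACA subrr add0r.
rewrite -mulmxBl -[B]trmxK -dot_mulmx /C.
apply: le_trans (ler_norm_sum _ _ _) _.
rewrite mulrDl mul1r mulr_suml -[leLHS]addr0 lerD ?enorm_ge0//.
by apply: ler_sum => i _; rewrite normrM mulrC ler_wpM2l// enorm_ge_coord.
Qed.

Lemma switching_points_finite : exists gs : seq R, forall s, Gamma s -> s \in gs.
Proof.
have /choice[g gP] : forall e, exists gs : seq R, edge_directions U e ->
    forall s, s \in `[0, T] -> dot (sigmahat s) e = 0 -> s \in gs.
  move=> e; have [Ee|nEe] := pselect (edge_directions U e); last by exists [::].
  have [gs H] := zeros_finite eta0_gt0 mu0_gt0 (fun s => growth Ee (s := s)).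
  by exists gs.
exists (flatten [seq g e | e <- es]) => s [sT [e Ee es0]].
apply/flattenP; exists (g e); last exact: gP.
by apply/mapP; exists e => //; exact: esP.
Qed.

Lemma switching_growth : exists2 c : R, 0 < c & forall eps t e,
  edge_directions U e -> t \in `[0, T] -> ~ (exists2 s, Gamma s & `|t - s| <= eps) ->
  Num.min (mu0 * eps) c <= `|dot (sigmahat t) e|.
Proof.
have [||c c0 cP] := @uniform_positive R _ es (edge_directions U) (fun e c =>
    forall eps t, t \in `[0, T] ->
      (forall s, s \in `[0, T] -> dot (sigmahat s) e = 0 -> eps < `|t - s|) ->
      Num.min (mu0 * eps) c <= `|dot (sigmahat t) e|).
- move=> e Ee.
  exact: (growth_off_zeros (ltW T0) eta0_gt0 mu0_gt0 (fun s => growth Ee (s := s))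
    (switching_ac e)).
- move=> e c c' cc' H eps t tT tZ; apply: le_trans (H eps t tT tZ).
  by rewrite le_min !ge_min lexx cc' orbT.
exists c => // eps t e Ee tT tG; apply: cP => //; first exact: esP.
move=> s sT se; rewrite ltNge; apply/negP => ts; apply: tG; exists s => //.
by split => //; exists e.
Qed.

(** The exceptional set in the definition of d* has measure of order eps, so that
    the L1-distance of controls is at most a constant times d*. *)
Lemma subregular_of_star : compact U ->
  strongly_subregular (Yspace P 0) (@Zspace R n m 0 T)
    (dist T) (dist_star T Gamma) (Znorm 0 T) (Phi P phat 0 (init P)) yhat ->
  strongly_subregular (Yspace P 0) (@Zspace R n m 0 T)
    (dist T) (dist T) (Znorm 0 T) (Phi P phat 0 (init P)) yhat.
Proof.
move=> cU [al [be [ka [al0 be0 ka0 H]]]].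
have aef := ae_filter_ringOfSetsType mu.
have [gs gsP] := switching_points_finite.
have [M M0 HM] := compact_coord_bounded cU.
(* a bound on the distance of two points of U *)
pose D := \sum_(i < m) (M + M).
have D0 : 0 <= D by apply: sumr_ge0 => i _; exact: addr_ge0.
pose C := T + 2 * D * (size gs)%:R.
have C0 : 0 < C by rewrite ltr_wpDr// !mulr_ge0.
exists al, be, (ka * (1 + C)); split => //; first by rewrite mulr_gt0// addr_gt0.
move=> y z Yy yal Zz Fz zbe; have {}H := H y z Yy yal Zz Fz zbe.
have [_ _ [_ Uu]] := Yy; have [_ _ [_ Uh]] := Yhat.
have L1le : (Lpnorm 1%:E 0 T (yu y \- yu yhat)%R <=
    C%:E * dist_ctrl_star T Gamma (yu y) (yu yhat))%E.
  rewrite -lee_pdivrMl//; apply: le_ereal_inf_tmp => _ [eps [eps0 He] <-].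
  rewrite lee_pdivrMl// -EFinM; apply: Lpnorm1_off_finite => //.
  - exact: ltW.
  - move: Uu Uh; rewrite /ae_itv; apply: filterS2 => t tu th tT.
    apply: le_trans (enorm_le_sum _) _; apply: ler_sum => i _; rewrite !mxE.
    by apply: le_trans (ler_normB _ _) _; apply: lerD; apply: HM; [exact: tu|exact: th].
  - move: He; rewrite /ae_itv; apply: filterS => t tH tT tgs.
    by apply: tH => // -[s /gsP/tgs]; rewrite ltNge => /negP.
have W0 k (x : R -> 'rV[R]_k) : (0 <= W11norm 0 T x)%E.
  by rewrite adde_ge0// Lnorm_ge0.
set w1 := W11norm 0 T (yx y \- yx yhat)%R in H *.
set w2 := W11norm 0 T (ylam y \- ylam yhat)%R in H *.
have dle : (dist T y yhat <= (1 + C)%:E * dist_star T Gamma y yhat)%E.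
  have ds0 : (0 <= dist_ctrl_star T Gamma (yu y) (yu yhat))%E.
    by apply: le_ereal_inf_tmp => _ [eps [eps0 _] <-]; rewrite lee_fin ltW.
  rewrite /dist /dist_star -/w1 -/w2.
  have C1 : 1 <= 1 + C by rewrite lerDl ltW.
  rewrite muleDr//; last by rewrite ge0_adde_def// inE// adde_ge0// W0.
  apply: leeD.
    rewrite -[leLHS]mul1e; apply: lee_wpmul2r; last by rewrite lee_fin.
    by rewrite adde_ge0// W0.
  apply: le_trans L1le _; apply: lee_wpmul2r => //; rewrite lee_fin; lra.
apply: le_trans dle _.
rewrite mulrC EFinM -muleA; apply: lee_wpmul2l => //.
by rewrite lee_fin addr_ge0// ltW.
Qed.

(** Off the eps-neighbourhood of the zeros the perturbation of the switching
    function is smaller than its component along every edge, so that the control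
    cannot change there. *)
Lemma star_of_subregular : polyhedron U -> compact U ->
  Phi P phat 0 (init P) yhat (Zzero R n m) ->
  strongly_subregular (Yspace P 0) (@Zspace R n m 0 T)
    (dist T) (dist T) (Znorm 0 T) (Phi P phat 0 (init P)) yhat ->
  strongly_subregular (Yspace P 0) (@Zspace R n m 0 T)
    (dist T) (dist_star T Gamma) (Znorm 0 T) (Phi P phat 0 (init P)) yhat.
Proof.
move=> [N [av [bv UE]]] cU [_ _ _ _ [wh Nwh whE]] [al [be [ka [al0 be0 ka0 H]]]].
have aef := ae_filter_ringOfSetsType mu.
have Ubnd : exists M : R, forall v i, U v -> `|v ord0 i| <= M.
  by have [M _ HM] := compact_coord_bounded cU; exists M.
have [c c0 cP] := switching_growth.
(* K r bounds the perturbation of the switching function along an edge if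
   r is the norm of z *)
pose K := \sum_(i < m) (\sum_(j < n) ((1 + (T - 0)^-1) * ka) * `|B j i| + 1).
have K0 : 0 <= K.
  apply: sumr_ge0 => i _; rewrite addr_ge0// sumr_ge0// => j _.
  by rewrite !mulr_ge0// ?(ltW ka0)// addr_ge0// invr_ge0 subr0 ltW.
(* the bound c / (K + 1) keeps K r below c, and eps > (K / mu0) r makes the
   growth mu0 eps exceed K r *)
exists al, (Num.min be (c / (K + 1))), (ka + K / mu0 + 1); split => //.
- by rewrite lt_min be0 divr_gt0// ltr_wpDl.
- by rewrite ltr_wpDl// addr_ge0// ?(ltW ka0)// divr_ge0// ltW.
move=> y z Yy yal Zz Fz.
have Lp0 k q (v : R -> 'rV[R]_k) : (0 <= Lpnorm q 0 T v)%E by exact: Lnorm_ge0.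
have zn0 : (0 <= Znorm 0 T z)%E.
  by rewrite /Znorm !adde_ge0// lee_fin enorm_ge0.
case znE : (Znorm 0 T z) zn0 => [r| |]//; rewrite !lee_fin => r0.
rewrite le_min => /andP[rbe rc].
have dle : (dist T y yhat <= (ka * r)%:E)%E.
  by rewrite EFinM -znE; apply: H => //; rewrite znE lee_fin.
have W0 k (x : R -> 'rV[R]_k) : (0 <= W11norm 0 T x)%E by rewrite adde_ge0.
have rho_r : (Lpnorm +oo%E 0 T (zrho z) <= r%:E)%E.
  by rewrite -znE /Znorm leeDr// !adde_ge0// lee_fin enorm_ge0.
have [_ acl [_ Uu]] := Yy; have [_ aclh [_ Uh]] := Yhat.
have lam_r j t : 0 <= t <= T ->
    `|(ylam y t - ylam yhat t) ord0 j| <= (1 + (T - 0)^-1) * (ka * r).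
  move=> tT; apply: (@W11norm_sup _ _ 0 T (ka * r) (ylam y \- ylam yhat)) => //.
    move=> i; rewrite [X in scalar_ac _ _ X](_ : _ =
        (fun t => ylam y t ord0 i) \- (fun t => ylam yhat t ord0 i)); last first.
      by apply/funext => u; rewrite /= !mxE.
    by apply: scalar_acB; exact: abs_continuous_coord.
  apply: le_trans dle; rewrite /dist.
  apply: (@le_trans _ _ (W11norm 0 T (yx y \- yx yhat)%R +
    W11norm 0 T (ylam y \- ylam yhat)%R)%E); first exact: leeDr.
  exact: leeDl.
have [_ _ _ _ [w Nw wE]] := Fz.
(* finitely many test values, the vertices, suffice *)
have Vae u w' : controls P 0 u -> normal_cone P 0 u w' ->
    ae_itv 0 T (fun t => forall v, vertex av bv U v -> dot (- w' t) (u t) <= dot (- w' t) v).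
  move=> cu Nw'.
  have : {ae mu, forall t, forall J : {set 'I_N}, t \in `[0, T] ->
      U (vertex_of av bv U J) -> dot (w' t) (vertex_of av bv U J - u t) <= 0}.
    apply: filter_forall => J.
    have [UJ|nUJ] := pselect (U (vertex_of av bv U J)); last by apply: aeW => t _ /nUJ.
    by have := normal_cone_ae cu Nw' UJ; rewrite /ae_itv; apply: filterS => t Ht tT _; exact: Ht.
  rewrite /ae_itv; apply: filterS => t Ht tT v Vv.
  have := Ht (active av bv v) tT; rewrite vertex_ofE//.
  by case: Vv => Uv _ /(_ Uv); rewrite dotBr !dotNl; lra.
have star eps : K / mu0 * r < eps ->
    (dist_ctrl_star T Gamma (yu y) (yu yhat) <= eps%:E)%E.
  move=> epsr; have eps0 : 0 < eps.
    by apply: le_lt_trans epsr; rewrite mulr_ge0// divr_ge0// ltW.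
  apply: ereal_inf_lbound; exists eps => //; split => //.
  have rho_ae : ae_itv 0 T (fun t => ((enorm (zrho z t))%:E <= r%:E)%E).
    by apply/Lpnorm_ooP => //; rewrite lee_fin.
  have [_ _ cy] := Yy; have [_ _ cyh] := Yhat.
  have Vy := ae_itvI Uu (ae_itvI (Vae _ _ cy Nw) wE).
  have Vyh := ae_itvI Uh (ae_itvI (Vae _ _ cyh Nwh) whE).
  apply: ae_itvS (ae_itvI rho_ae (ae_itvI Vy Vyh)) => t tT.
  move=> [tr [[tU [tV tw]] [thU [thV thw]]]] tG.
  have [->|uN] := eqVneq (yu y t) (yu yhat t).
    by rewrite subrr -(scale0r (0 : 'rV[R]_m)) enormZ normr0 mul0r ltW.
  have [e Ee eprod] := argmin_change UE Ubnd thU tU (contra_neq esym uN) thV tV.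
  have sE : - wh t = sigmahat t.
    by apply/eqP; rewrite eq_sym -addr_eq0; apply/eqP/esym; exact: thw.
  have sE' : - w t = b + ylam y t *m B - zrho z t.
    by rewrite tw gradE; apply/rowP => i; rewrite !mxE; ring.
  have e1 : enorm e = 1 by case: Ee.
  have Kr_lt : K * r < Num.min (mu0 * eps) c.
    rewrite lt_min; apply/andP; split.
      by move: epsr; rewrite mulrAC ltr_pdivrMr// (mulrC eps).
    apply: (@le_lt_trans _ _ (K * (c / (K + 1)))); first exact: ler_wpM2l.
    by rewrite mulrCA gtr_pMr// ltr_pdivrMr ?mul1r ?ltrDl// ltr_wpDl.
  have sdiff : - wh t - - w t = (ylam yhat t - ylam y t) *m B + zrho z t.
    by rewrite sE sE' /switching gradE mulmxBl; apply/rowP => i; rewrite !mxE; ring.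
  have Kr_ge : `|dot (- wh t) e| <= K * r.
    apply: le_trans (norm_le_dist_opposite eprod) _.
    rewrite -dotBl sdiff; apply: le_trans (dot_le_sum _ e1) _.
    rewrite /K mulr_suml; apply: ler_sum => i _.
    rewrite mxE mulrDl mul1r; apply: le_trans (ler_normD _ _) _; apply: lerD.
      rewrite mxE; apply: le_trans (ler_norm_sum _ _ _) _.
      rewrite mulr_suml; apply: ler_sum => j _; rewrite normrM mulrAC.
      apply: ler_wpM2r => //; rewrite -mulrA.
      have := lam_r j t; rewrite !mxE distrC; apply.
      by move: tT; rewrite in_itv.
    by apply: le_trans (enorm_ge_coord _ i) _; rewrite -lee_fin.
  have := cP eps t e Ee tT tG; rewrite -sE => /(lt_le_trans Kr_lt).
  by move=> /lt_le_trans/(_ Kr_ge); rewrite ltxx.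
have dstar : (dist_ctrl_star T Gamma (yu y) (yu yhat) <= (K / mu0 * r)%:E)%E.
  apply/lee_addgt0Pr => e e0; rewrite -EFinD; apply: star; rewrite ltrDl//.
have wle : (W11norm 0 T (yx y \- yx yhat)%R + W11norm 0 T (ylam y \- ylam yhat)%R
    <= (ka * r)%:E)%E.
  by apply: le_trans dle; rewrite /dist; exact: leeDl.
apply: le_trans (leeD wle dstar) _; rewrite -EFinD -EFinM lee_fin.
by rewrite -mulrDl ler_wpM2r// lerDl.
Qed.

End regularity.

Theorem theorem4p2 (R : realType) (l n m : nat) (P : problem R l n m) (L : R)
    (phat : R -> 'rV[R]_l) (yhat : Ypoint R n m) :
  standing P ->
  affine_in_control P ->
  polyhedron (ctrlset P) ->
  assumption_A1 P L ->
  assumption_A2 P ->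
  params P phat ->
  optimal_solution P phat 0 (init P) (yx yhat) (yu yhat) ->
  Yspace P 0 yhat ->
  Phi P phat 0 (init P) yhat (Zzero R n m) ->
  assumption_C1 (horizon P) (ctrlset P) (switching P phat yhat) ->
  let T := horizon P in
  let Gamma := switching_points T (ctrlset P) (switching P phat yhat) in
  strongly_subregular (Yspace P 0) (@Zspace R n m 0 T)
    (dist T) (dist T) (Znorm 0 T) (Phi P phat 0 (init P)) yhat
  <->
  strongly_subregular (Yspace P 0) (@Zspace R n m 0 T)
    (dist T) (dist_star T Gamma) (Znorm 0 T) (Phi P phat 0 (init P)) yhat.
Proof.
move=> [T0 _ _] aff poly A1 _ _ _ Yhat Phihat [eta0 [mu0 [eta0_gt0 mu0_gt0 growth]]] /=.
have [b [B gradE]] := grad_u_H_affine aff A1.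
have [N [av [bv UE]]] := poly.
have [es esP] := edge_directions_finite UE.
have [_ cU _ _ _] := A1.
split.
  exact: (star_of_subregular gradE esP T0 Yhat eta0_gt0 mu0_gt0 growth).
exact: (subregular_of_star esP T0 Yhat eta0_gt0 mu0_gt0 growth).
Qed.
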